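(* Let $(\beta_i)_{i=1}^\infty$ be any sequence in $(1,2)$ such that the $\beta_i$-expansion of $1$ terminates for each $i$. Then the set of $x\in[0,1)$ such that for every $i$, every $m\in\mathbb N$ and every word $w\in\{0,1\}^m$, the sequence $\tau^{\beta_i}_w(x,n)/(n-m)$ does not converge as $n\to\infty$, has Hausdorff dimension $1$.
   Context: For $\beta\in(1,2)$ let $f_\beta(x)=\beta x \bmod 1$ on $[0,1)$ and, for $x\in[0,1]$, $d_n(x,\beta)=\lfloor \beta f_\beta^n(x)\rfloor$, $n\ge 0$; the sequence $d(x,\beta)=(d_n(x,\beta))_{n\ge0}\in\{0,1\}^{\mathbb N}$ is the $\beta$-expansion of $x$, and $x=\sum_{k\ge0} d_k(x,\beta)\beta^{-(k+1)}$. The expansion of $1$ terminates if $d(1,\beta)=j_0\dots j_{k-1}0^\infty$ for some finite word. For $x$ with $\beta$-expansion $(x_i)_{i\ge0}$, a word $w$ of length $m$ and $n>m$, $\tau^\beta_w(x,n)=\#\{i\in\{0,\dots,n-m-1\}: x_i\dots x_{i+m-1}=w\}$.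
   Formalization: ''Every word'' is restricted to nonempty words that occur in the β_i-expansion of some point of [0,1); otherwise the claim is false: for the golden mean the word 11 never occurs, so its frequency is constantly 0 and the set is empty. *)

(* Defs.v *)
From Stdlib Require Import Reals Lra Lia List Arith.
Import ListNotations.
Open Scope R_scope.

Definition fbeta (beta x : R) : R := frac_part (beta * x).

Definition digit (beta x : R) (n : nat) : nat :=
  Z.to_nat (Int_part (beta * Nat.iter n (fbeta beta) x)).

Definition expansion_of_one_terminates (beta : R) : Prop :=
  exists k : nat, forall n : nat, (k <= n)%nat -> digit beta 1 n = 0%nat.

Definition binary_word (w : list nat) : Prop := Forall (fun a => (a <= 1)%nat) w.

Definition block (beta x : R) (i m : nat) : list nat :=
  map (fun k => digit beta x (i + k)) (seq 0 m).

Definition tau (beta : R) (w : list nat) (x : R) (n : nat) : nat :=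
  length (filter (fun i => if list_eq_dec Nat.eq_dec (block beta x i (length w)) w
                           then true else false)
                 (seq 0 (n - length w))).

Definition admissible_word (beta : R) (w : list nat) : Prop :=
  exists y : R, 0 <= y < 1 /\ exists i : nat, block beta y i (length w) = w.

(* d^s with the convention 0^s = 0 (only used for s > 0) *)
Definition pw (d s : R) : R := if Rlt_dec 0 d then Rpower d s else 0.

Definition diam_le (U : R -> Prop) (d : R) : Prop :=
  forall x y, U x -> U y -> Rabs (x - y) <= d.

(* H^s(E) = 0, i.e. for every delta > 0, H^s_delta(E) = 0:
   for all delta, eps > 0 there is a countable delta-cover (U_k) of E
   with sum_k diam(U_k)^s <= eps. *)
Definition hausdorff_null (s : R) (E : R -> Prop) : Prop :=
  forall delta eps : R, 0 < delta -> 0 < eps ->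
    exists (U : nat -> R -> Prop) (d : nat -> R),
      (forall k, 0 <= d k <= delta /\ diam_le (U k) (d k)) /\
      (forall x, E x -> exists k, U k x) /\
      (forall N, sum_f_R0 (fun k => pw (d k) s) N <= eps).

Definition is_glb (P : R -> Prop) (m : R) : Prop :=
  (forall s, P s -> m <= s) /\ (forall b, (forall s, P s -> b <= s) -> b <= m).

Definition hausdorff_dim_eq (E : R -> Prop) (D : R) : Prop :=
  is_glb (fun s => 0 < s /\ hausdorff_null s E) D.

(* Main.v *)
(* Fix s < 1 and a cover (U_k) with weights v_k = d_k^s of small total mass.  A
   point of the set outside every U_k is found by playing a game: choose nested
   closed intervals J, keeping the load of J, i.e. the total weight of the U_k
   that touch J, below a constant times |J|^s.  If J has many equally long,
   separated children, averaging yields a child whose relative load is halved;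
   after enough such moves the game can continue with another base beta_i, since
   every interval contains a comparable full beta_i-cylinder.  Hence countably
   many requirements can be met in turn.

   Because the expansion of 1 terminates, each word followed by a fixed number of
   zeros is full, so about beta^q full words of length q are available.  By
   pigeonhole, at least a fraction 1/(const + q) of them contain w the same number
   of times.  Appending to all of these one of two fixed full words of equal
   length, in which w occurs markedly rarely, respectively often, gives two
   families of blocks, each of exponential growth rate arbitrarily close to
   log beta, whose concatenations have frequencies of w at most c1, respectively
   at least c2 > c1.  Playing both families infinitely often makes the frequency
   oscillate. *)
Require Import Defs.
From Stdlib Require Import Reals List.
From Stdlib Require Import Lra Lia Arith ZArith Cantor.
From Stdlib Require Import Classical ClassicalEpsilon.
Import ListNotations.
Open Scope R_scope.

(** * Full words of the beta-shift *)

Lemma Int_part_eq (r : R) (z : Z) : IZR z <= r < IZR z + 1 -> Int_part r = z.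
Proof. intros H. symmetry. apply Int_part_spec. lra. Qed.

Lemma fbeta_bounds (beta x : R) : 0 <= fbeta beta x < 1.
Proof. unfold fbeta. destruct (base_fp (beta * x)). lra. Qed.

Lemma iter_fbeta_bounds (beta x : R) (n : nat) :
  0 <= x < 1 -> 0 <= Nat.iter n (fbeta beta) x < 1.
Proof. destruct n; simpl; [easy | intros _; apply fbeta_bounds]. Qed.

Lemma digit_zero (beta y : R) (n : nat) (x : R) :
  Nat.iter n (fbeta beta) x = y -> 0 <= beta * y < 1 ->
  digit beta x n = 0%nat /\ fbeta beta y = beta * y.
Proof.
  intros E H. unfold digit. rewrite E. unfold fbeta, frac_part.
  rewrite (Int_part_eq _ 0%Z) by (simpl; lra). split; [reflexivity | simpl; lra].
Qed.

Lemma digit_one (beta y : R) (n : nat) (x : R) :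
  Nat.iter n (fbeta beta) x = y -> 1 <= beta * y < 2 ->
  digit beta x n = 1%nat /\ fbeta beta y = beta * y - 1.
Proof.
  intros E H. unfold digit. rewrite E. unfold fbeta, frac_part.
  rewrite (Int_part_eq _ 1%Z) by (simpl; lra). split; [reflexivity | simpl; lra].
Qed.

Lemma digit_iter (beta x : R) (m n : nat) :
  digit beta x (m + n) = digit beta (Nat.iter m (fbeta beta) x) n.
Proof.
  unfold digit. now rewrite Nat.add_comm, Nat.iter_add.
Qed.

Lemma block_iter (beta x : R) (n i m : nat) :
  block beta x (n + i) m = block beta (Nat.iter n (fbeta beta) x) i m.
Proof.
  unfold block. apply map_ext. intros k.
  now rewrite <- Nat.add_assoc, digit_iter.
Qed.

Lemma block_add (beta x : R) (i m n : nat) :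
  block beta x i (m + n) = block beta x i m ++ block beta x (i + m) n.
Proof.
  unfold block. rewrite seq_app, map_app. f_equal.
  replace (seq (0 + m) n) with (map (fun k => (m + k)%nat) (seq 0 n)).
  - rewrite map_map. apply map_ext. intros k. f_equal. lia.
  - clear. revert m; induction n as [|n IH]; intros m; [reflexivity|].
    rewrite !seq_S, map_app, IH. reflexivity.
Qed.

Lemma block_length (beta x : R) (i m : nat) : length (block beta x i m) = m.
Proof. unfold block. now rewrite length_map, length_seq. Qed.

Fixpoint val (beta : R) (u : list nat) : R :=
  match u with
  | [] => 0
  | d :: u' => (INR d + val beta u') / beta
  end.

(** The inverse branch, along the digits [u], of the [length u]-th iterate of the
    beta-transformation: an affine map of slope beta^-|u|. *)
Definition point (beta : R) (u : list nat) (y : R) : R :=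
  val beta u + y / beta ^ length u.

Lemma point_app (beta : R) (u v : list nat) (y : R) :
  1 < beta -> point beta (u ++ v) y = point beta u (point beta v y).
Proof.
  intros Hb. unfold point. rewrite length_app, pow_add.
  assert (P : forall n, beta ^ n <> 0) by (intros n; apply pow_nonzero; lra).
  enough (E : val beta (u ++ v) = val beta u + val beta v / beta ^ length u).
  { rewrite E. field. auto. }
  induction u as [|d u IH]; simpl.
  - field.
  - rewrite IH. field. split; [apply P | lra].
Qed.

(* The image under the |u|-th iterate of the cylinder of u contains [0,c). *)
Definition opens (beta : R) (u : list nat) (c : R) : Prop :=
  forall y, 0 <= y < c ->
    0 <= point beta u y < 1 /\
    Nat.iter (length u) (fbeta beta) (point beta u y) = y /\
    block beta (point beta u y) 0 (length u) = u.

Lemma opens_weaken (beta : R) (u : list nat) (c c' : R) :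
  c' <= c -> opens beta u c -> opens beta u c'.
Proof. intros H O y Hy. apply O. lra. Qed.

Lemma opens_nil (beta : R) : opens beta [] 1.
Proof.
  intros y Hy. unfold point; simpl. replace (0 + y / 1) with y by field. easy.
Qed.

Lemma opens_app (beta : R) (u v : list nat) (c c' : R) :
  1 < beta -> opens beta u c -> opens beta v c' ->
  (forall y, 0 <= y < c' -> point beta v y < c) ->
  opens beta (u ++ v) c'.
Proof.
  intros Hb Hu Hv Hc y Hy.
  rewrite point_app by assumption.
  destruct (Hv y Hy) as (V1 & V2 & V3).
  destruct (Hu (point beta v y)) as (U1 & U2 & U3).
  { split; [apply V1 | now apply Hc]. }
  split; [assumption|]. rewrite length_app. split.
  - now rewrite Nat.add_comm, Nat.iter_add, U2.
  - rewrite block_add, U3, (Nat.add_comm 0), block_iter, U2, V3. reflexivity.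
Qed.

(** [opens beta u 1] is fullness of [u]: the cylinder is mapped onto all of [0,1), so it puts no
    restriction on the digits that follow. *)
Lemma full_app (beta : R) (u v : list nat) :
  1 < beta -> opens beta u 1 -> opens beta v 1 -> opens beta (u ++ v) 1.
Proof.
  intros Hb Hu Hv. apply opens_app with 1; try assumption.
  intros y Hy. now apply Hv.
Qed.

Lemma opens_digit0 (beta : R) : 1 < beta -> opens beta [0%nat] 1.
Proof.
  intros Hb y Hy. unfold point; simpl.
  replace ((0 + 0) / beta + y / (beta * 1)) with (y / beta) by (field; lra).
  assert (E : beta * (y / beta) = y) by (field; lra).
  destruct (digit_zero beta (y / beta) 0 (y / beta)) as [D F];
    [reflexivity | lra |].
  split; [|split].
  - split.
    + apply Rmult_le_pos; [lra | left; apply Rinv_0_lt_compat; lra].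
    + apply Rmult_lt_reg_l with beta; lra.
  - lra.
  - cbn. now rewrite D.
Qed.

(** The bound is f_beta(1): the point (1 + y) / beta has to stay below 1. *)
Lemma opens_digit1 (beta : R) : 1 < beta < 2 -> opens beta [1%nat] (beta - 1).
Proof.
  intros Hb y Hy. unfold point; simpl.
  replace ((1 + 0) / beta + y / (beta * 1)) with ((1 + y) / beta) by (field; lra).
  assert (E : beta * ((1 + y) / beta) = 1 + y) by (field; lra).
  destruct (digit_one beta ((1 + y) / beta) 0 ((1 + y) / beta)) as [D F];
    [reflexivity | lra |].
  split; [|split].
  - split.
    + apply Rmult_le_pos; [lra | left; apply Rinv_0_lt_compat; lra].
    + apply Rmult_lt_reg_l with beta; lra.
  - lra.
  - cbn. now rewrite D.
Qed.

Lemma val_zeros (beta : R) (z : nat) : 1 < beta -> val beta (repeat 0%nat z) = 0.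
Proof. intros Hb. induction z; simpl; [reflexivity | rewrite IHz; field; lra]. Qed.

Lemma full_zeros (beta : R) (z : nat) : 1 < beta -> opens beta (repeat 0%nat z) 1.
Proof.
  intros Hb. induction z as [|z IH]; [apply opens_nil|].
  apply (full_app beta [0%nat]); auto using opens_digit0.
Qed.

(** The values that occur as right ends of follower sets; see [follower_set]. *)
Definition orbit_of_one (beta c : R) : Prop :=
  0 < c <= 1 /\ exists j, c = Nat.iter j (fbeta beta) 1.

Lemma pow_exceeds (b K : R) : 1 < b -> exists n, K < b ^ n.
Proof.
  intros Hb. destruct (Pow_x_infinity b) with (b := K + 1) as [n Hn].
  - rewrite Rabs_right; lra.
  - exists n. specialize (Hn n (le_n n)).
    rewrite Rabs_right in Hn; [lra|]. apply Rle_ge, pow_le; lra.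
Qed.

(** Once the digits of 1 vanish, each iterate is beta times the previous one. The orbit is bounded,
    so it has already reached 0 at time [k]. Hence only the finitely many iterates before [k] can be
    positive. *)
Lemma orbit_of_one_min (beta : R) :
  1 < beta -> expansion_of_one_terminates beta ->
  exists c0, 0 < c0 /\ forall c, orbit_of_one beta c -> c0 <= c.
Proof.
  intros Hb [k Hk].
  assert (B : forall j, 0 <= Nat.iter j (fbeta beta) 1 <= 1).
  { intros [|j]; simpl; [lra|].
    destruct (fbeta_bounds beta (Nat.iter j (fbeta beta) 1)); lra. }
  assert (S1 : forall n, (k <= n)%nat ->
     fbeta beta (Nat.iter n (fbeta beta) 1) = beta * Nat.iter n (fbeta beta) 1).
  { intros n Hn. specialize (Hk n Hn). specialize (B n).
    unfold digit in Hk. unfold fbeta at 1. unfold frac_part.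
    set (r := beta * Nat.iter n (fbeta beta) 1) in *.
    assert (0 <= r) by (unfold r; nra).
    destruct (base_Int_part r) as [I1 I2].
    (* [Z.to_nat] sends negative integers to 0 as well, so a zero digit determines [Int_part r] only
       after its sign is known. *)
    assert (0 <= Int_part r)%Z.
    { assert (-1 < Int_part r)%Z by (apply lt_IZR; lra). lia. }
    replace (Int_part r) with 0%Z by lia. lra. }
  assert (S2 : forall n, Nat.iter (n + k) (fbeta beta) 1
                         = beta ^ n * Nat.iter k (fbeta beta) 1).
  { induction n as [|n IH]; [simpl; lra|].
    change (fbeta beta (Nat.iter (n + k) (fbeta beta) 1)
            = beta ^ S n * Nat.iter k (fbeta beta) 1).
    rewrite S1 by lia. rewrite IH. simpl. ring. }
  assert (Z0 : Nat.iter k (fbeta beta) 1 = 0).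
  { destruct (B k) as [[Hp|E] _]; [|now symmetry].
    destruct (pow_exceeds beta (/ Nat.iter k (fbeta beta) 1) Hb) as [n Hn].
    exfalso. specialize (B (n + k)%nat). rewrite S2 in B.
    apply (Rmult_lt_compat_r _ _ _ Hp) in Hn.
    rewrite Rinv_l in Hn by lra. lra. }
  assert (F : forall K, exists c0, 0 < c0 /\ forall j, (j < K)%nat ->
      0 < Nat.iter j (fbeta beta) 1 -> c0 <= Nat.iter j (fbeta beta) 1).
  { induction K as [|K (c0 & P & IH)].
    - exists 1. split; [lra | lia].
    - destruct (Rle_lt_dec (Nat.iter K (fbeta beta) 1) 0) as [L|L].
      + exists c0. split; [assumption|]. intros j Hj Hp.
        destruct (Nat.eq_dec j K) as [->|]; [lra | apply IH; [lia | assumption]].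
      + exists (Rmin c0 (Nat.iter K (fbeta beta) 1)).
        split; [now apply Rmin_pos|]. intros j Hj Hp.
        destruct (Nat.eq_dec j K) as [->|]; [apply Rmin_r|].
        eapply Rle_trans; [apply Rmin_l | apply IH; [lia | assumption]]. }
  destruct (F k) as (c0 & P & G). exists c0. split; [assumption|].
  intros c [Hc [j ->]]. apply G; [|lra].
  destruct (Nat.lt_ge_cases j k) as [|L]; [assumption|]. exfalso.
  replace j with ((j - k) + k)%nat in Hc by lia. rewrite S2, Z0 in Hc. lra.
Qed.

(** Induction on [q]. Appending the digit 1 turns the right end [c] into [beta * c - 1]. Appending 0
    turns it into [beta * c], cut off at 1. So the right end moves along the orbit of 1 or restarts
    at 1. *)
Lemma follower_set (beta x : R) (q : nat) :
  1 < beta < 2 -> 0 <= x < 1 ->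
  exists c, orbit_of_one beta c /\ opens beta (block beta x 0 q) c /\
    Nat.iter q (fbeta beta) x < c /\
    point beta (block beta x 0 q) (Nat.iter q (fbeta beta) x) = x.
Proof.
  intros Hb Hx. induction q as [|q (c & [Hc [j Hj]] & O & L & E)].
  - exists 1. split; [split; [lra | now exists 0%nat]|].
    split; [apply opens_nil|]. simpl. split; [lra|]. unfold point; simpl. field.
  - assert (Eb : block beta x 0 (S q) = block beta x 0 q ++ [digit beta x q]).
    { rewrite <- Nat.add_1_r, block_add. cbn. now rewrite Nat.add_0_r. }
    rewrite Eb.
    change (Nat.iter (S q) (fbeta beta) x)
      with (fbeta beta (Nat.iter q (fbeta beta) x)).
    pose proof (iter_fbeta_bounds beta x q Hx) as Hy.
    remember (Nat.iter q (fbeta beta) x) as y eqn:Ey. symmetry in Ey.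
    rewrite point_app by lra.
    destruct (Rlt_le_dec (beta * y) 1) as [D|D].
    + destruct (digit_zero beta y q x Ey) as [-> ->]; [split; nra|].
      assert (Ep : forall t, point beta [0%nat] t = t / beta)
        by (intros t; unfold point; simpl; field; lra).
      assert (Ei : / beta > 0) by (apply Rinv_0_lt_compat; lra).
      assert (Em : beta * / beta = 1) by (field; lra).
      assert (Hpt : point beta (block beta x 0 q) (point beta [0%nat] (beta * y)) = x).
      { rewrite Ep. replace (beta * y / beta) with y by (field; lra). exact E. }
      destruct (Rlt_le_dec (beta * c) 1) as [C|C].
      * exists (beta * c). split; [|split; [|split]].
        -- split; [nra|]. exists (S j). simpl. rewrite <- Hj.
           symmetry. apply (digit_zero beta c 0 c eq_refl). nra.
        -- apply opens_app with c; [lra | assumption | |].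
           ++ apply opens_weaken with 1; [lra | apply opens_digit0; lra].
           ++ intros t Ht. rewrite Ep. unfold Rdiv. nra.
        -- nra.
        -- exact Hpt.
      * exists 1. split; [|split; [|split]].
        -- split; [lra | now exists 0%nat].
        -- apply opens_app with c; [lra | assumption | apply opens_digit0; lra |].
           intros t Ht. rewrite Ep. unfold Rdiv. nra.
        -- lra.
        -- exact Hpt.
    + destruct (digit_one beta y q x Ey) as [-> ->]; [split; nra|].
      assert (Ep : forall t, point beta [1%nat] t = (1 + t) / beta)
        by (intros t; unfold point; simpl; field; lra).
      assert (Ei : / beta > 0) by (apply Rinv_0_lt_compat; lra).
      assert (Em : beta * / beta = 1) by (field; lra).
      exists (beta * c - 1). split; [|split; [|split]].
      * split; [nra|]. exists (S j). simpl. rewrite <- Hj.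
        symmetry. apply (digit_one beta c 0 c eq_refl). nra.
      * apply opens_app with c; [lra | assumption | |].
        -- apply opens_weaken with (beta - 1); [nra | apply opens_digit1; lra].
        -- intros t Ht. rewrite Ep. unfold Rdiv. nra.
      * nra.
      * rewrite Ep. replace ((1 + (beta * y - 1)) / beta) with y by (field; lra). exact E.
Qed.

(* Unlike [opens beta u 1], this also keeps the right end point of the closed
   cylinder inside [0,1). *)
Definition inner (beta : R) (u : list nat) : Prop :=
  opens beta u 1 /\ point beta u 1 < 1.

Lemma point_mono (beta y y' : R) (u : list nat) :
  1 < beta -> y <= y' -> point beta u y <= point beta u y'.
Proof.
  intros Hb H. unfold point, Rdiv. apply Rplus_le_compat_l, Rmult_le_compat_r; [|assumption].
  left. apply Rinv_0_lt_compat, pow_lt. lra.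
Qed.

Lemma point_mono_strict (beta y y' : R) (u : list nat) :
  1 < beta -> y < y' -> point beta u y < point beta u y'.
Proof.
  intros Hb H. unfold point, Rdiv. apply Rplus_lt_compat_l, Rmult_lt_compat_r; [|assumption].
  apply Rinv_0_lt_compat, pow_lt. lra.
Qed.

Lemma full_point_le (beta : R) (u : list nat) :
  1 < beta -> opens beta u 1 -> 0 <= point beta u 0 /\ point beta u 1 <= 1.
Proof.
  intros Hb O. split; [apply O; lra|].
  destruct (Rle_lt_dec (point beta u 1) 1) as [|L]; [assumption|]. exfalso.
  assert (P : 0 < / beta ^ length u) by (apply Rinv_0_lt_compat, pow_lt; lra).
  unfold point, Rdiv in L. rewrite Rmult_1_l in L.
  set (d := val beta u + / beta ^ length u - 1) in *.
  assert (Hd : 0 < d) by (unfold d; lra).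
  set (r := / beta ^ length u) in *.
  assert (V : val beta u < 1).
  { destruct (O 0 ltac:(lra)) as [[_ V] _]. unfold point, Rdiv in V. lra. }
  (* The inverse branch would send this parameter, which is below 1, exactly to 1, contrary to
     [opens]. *)
  assert (Y : 0 <= (1 - val beta u) / r < 1).
  { split.
    - apply Rmult_le_pos; [lra | left; now apply Rinv_0_lt_compat].
    - apply Rmult_lt_reg_r with r; [assumption|]. unfold Rdiv.
      rewrite Rmult_assoc, Rinv_l by lra. unfold d in Hd. lra. }
  destruct (O _ Y) as [[_ C] _]. unfold point, Rdiv in C. fold r in C.
  rewrite Rmult_assoc, Rinv_l in C by lra. lra.
Qed.

Lemma inner_app (beta : R) (u v : list nat) :
  1 < beta -> inner beta u -> opens beta v 1 -> inner beta (u ++ v).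
Proof.
  intros Hb [O I] V. split; [now apply full_app|].
  rewrite point_app by assumption.
  eapply Rle_lt_trans; [|apply I]. apply point_mono; [assumption|].
  now apply full_point_le.
Qed.

(** A run of [z] zeros contracts the closed unit interval into [0, beta^-z]. Every follower set
    contains [0, c0) with c0 independent of the word, so one [z] with beta^-z < c0 serves all words;
    the strict inequality also takes care of the right end point. *)
Lemma padding (beta : R) :
  1 < beta < 2 -> expansion_of_one_terminates beta ->
  exists z, forall x q, 0 <= x < 1 -> inner beta (block beta x 0 q ++ repeat 0%nat z).
Proof.
  intros Hb Ht. destruct (orbit_of_one_min beta) as (c0 & P & M); [lra | assumption |].
  destruct (pow_exceeds beta (/ c0)) as [z Hz]; [lra|].
  assert (Bz : 0 < beta ^ z) by (apply pow_lt; lra).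
  assert (L : 1 / beta ^ z < c0).
  { apply Rmult_lt_reg_r with (beta ^ z); [assumption|].
    unfold Rdiv. rewrite Rmult_assoc, Rinv_l by lra.
    apply (Rmult_lt_compat_l c0) in Hz; [|assumption]. rewrite Rinv_r in Hz by lra. lra. }
  exists z. intros x q Hx. destruct (follower_set beta x q Hb Hx) as (c & C & O & _ & _).
  pose proof (M c C) as Mc.
  assert (E : forall y, point beta (repeat 0%nat z) y = y / beta ^ z).
  { intros y. unfold point. rewrite val_zeros, repeat_length by lra. ring. }
  assert (Iz : 0 < / beta ^ z) by now apply Rinv_0_lt_compat.
  split.
  - apply opens_app with c; [lra | assumption | apply full_zeros; lra |].
    intros y Hy. rewrite E. unfold Rdiv in *. nra.
  - rewrite point_app, E by lra. apply O. unfold Rdiv in *. nra.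
Qed.

(** * A game against covers *)

Definition touches (U : R -> Prop) (a b : R) : Prop := exists x, U x /\ a <= x <= b.

Definition touch_weight (v : nat -> R) (U : nat -> R -> Prop) (a b : R) (k : nat) : R :=
  if excluded_middle_informative (touches (U k) a b) then v k else 0.

(** The weights are nonnegative in all uses, so bounding the partial sums bounds the total load
    without speaking of an infinite sum. *)
Definition load_le (v : nat -> R) (U : nat -> R -> Prop) (a b t : R) : Prop :=
  forall N, sum_f_R0 (touch_weight v U a b) N <= t.

(* [v k] plays the role of [d_k ^ s]; it is kept positive so that covering sets
   of diameter 0 are also charged. *)
Definition cover_system (s : R) (v : nat -> R) (U : nat -> R -> Prop) : Prop :=
  forall k, 0 < v k /\ diam_le (U k) (Rpower (v k) (/ s)).

(** The entry threshold [thr] depends on [P] and [s] only, neither on the cover nor on the interval,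
    while the exit constant [c] is arbitrary. Taking for [c] the threshold of another requirement
    makes moves composable. *)
Definition playable (s : R) (P : R -> Prop) : Prop :=
  exists thr, 0 < thr /\
    forall v U, cover_system s v U ->
    forall a b, 0 <= a < b -> b <= 1 -> load_le v U a b (thr * Rpower (b - a) s) ->
    forall c, 0 < c ->
    exists a' b', a <= a' < b' /\ b' <= b /\
      load_le v U a' b' (c * Rpower (b' - a') s) /\
      forall x, a' <= x <= b' -> P x.

Lemma load_le_weaken v U a b t t' : t <= t' -> load_le v U a b t -> load_le v U a b t'.
Proof. intros H L N. specialize (L N). lra. Qed.

Lemma touch_weight_mono v U a b a' b' k :
  0 < v k -> a <= a' -> b' <= b -> touch_weight v U a' b' k <= touch_weight v U a b k.
Proof.
  intros Hv Ha Hb. unfold touch_weight.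
  destruct (excluded_middle_informative (touches (U k) a' b')) as [(x & Ux & Hx)|];
  destruct (excluded_middle_informative (touches (U k) a b)) as [|T]; try lra.
  exfalso. apply T. exists x. split; [assumption | lra].
Qed.

Lemma load_le_mono s v U a b a' b' t :
  cover_system s v U -> a <= a' -> b' <= b -> load_le v U a b t -> load_le v U a' b' t.
Proof.
  intros S Ha Hb L N. eapply Rle_trans; [|apply (L N)].
  apply sum_Rle. intros k _. apply touch_weight_mono; try assumption. apply S.
Qed.

Lemma touch_weight_nonneg s v U a b k : cover_system s v U -> 0 <= touch_weight v U a b k.
Proof.
  intros S. unfold touch_weight. destruct (S k).
  destruct (excluded_middle_informative _); lra.
Qed.

Lemma sum_ge_term (f : nat -> R) (k : nat) :
  (forall j, 0 <= f j) -> f k <= sum_f_R0 f k.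
Proof.
  intros P. destruct k; simpl; [lra|]. pose proof (cond_pos_sum f k P). lra.
Qed.

Lemma touched_weight_le s v U a b t k :
  cover_system s v U -> load_le v U a b t -> touches (U k) a b -> v k <= t.
Proof.
  intros S L T. eapply Rle_trans; [|apply (L k)].
  eapply Rle_trans; [|apply sum_ge_term; intros; eapply touch_weight_nonneg, S].
  unfold touch_weight. destruct (excluded_middle_informative _); [lra | contradiction].
Qed.

(** The first move is played with the threshold of the second as its exit constant. *)
Lemma playable_and s P Q :
  playable s P -> playable s Q -> playable s (fun x => P x /\ Q x).
Proof.
  intros (t1 & T1 & H1) (t2 & T2 & H2). exists t1. split; [assumption|].
  intros v U S a b Ha Hb L c Hc.
  destruct (H1 v U S a b Ha Hb L t2 T2) as (a1 & b1 & Ha1 & Hb1 & L1 & P1).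
  destruct (H2 v U S a1 b1 ltac:(lra) ltac:(lra) L1 c Hc) as (a2 & b2 & Ha2 & Hb2 & L2 & P2).
  exists a2, b2. split; [lra|]. split; [lra|]. split; [assumption|].
  intros x Hx. split; [apply P1 | apply P2]; lra.
Qed.

Lemma choice_fun (A B : Type) (R : A -> B -> Prop) :
  (forall x, exists y, R x y) -> exists f : A -> B, forall x, R x (f x).
Proof.
  intros H. exists (fun x => proj1_sig (constructive_indefinite_description _ (H x))).
  intros x. apply (proj2_sig (constructive_indefinite_description _ (H x))).
Qed.

Lemma nested_intervals (a b : nat -> R) :
  (forall n, a n <= a (S n) /\ b (S n) <= b n /\ a n <= b n) ->
  exists x, forall n, a n <= x <= b n.
Proof.
  intros H.
  assert (A : forall m n, (m <= n)%nat -> a m <= a n /\ b n <= b m).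
  { intros m n L. induction L as [|n L IH]; [lra|]. specialize (H n). lra. }
  assert (AB : forall m n, a m <= b n).
  { intros m n. destruct (Nat.le_ge_cases m n) as [L|L]; destruct (A _ _ L).
    - specialize (H n). lra.
    - specialize (H m). lra. }
  destruct (completeness (fun y => exists n, y = a n)) as [x [X1 X2]].
  - exists (b 0%nat). intros y [n ->]. apply AB.
  - exists (a 0%nat). now exists 0%nat.
  - exists x. intros n. split.
    + apply X1. now exists n.
    + apply X2. intros y [m ->]. apply AB.
Qed.

Lemma Rpower_base_1 (s : R) : Rpower 1 s = 1.
Proof. unfold Rpower. rewrite ln_1, Rmult_0_r. apply exp_0. Qed.

Lemma Rpower_le_1 (x s : R) : 0 < x <= 1 -> 0 < s -> Rpower x s <= 1.
Proof.
  intros Hx Hs. rewrite <- (Rpower_base_1 s). apply Rle_Rpower_l; lra.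
Qed.

Lemma Rpower_pos (x s : R) : 0 < Rpower x s.
Proof. apply exp_pos. Qed.

(** Move j ends with a relative load below both the next threshold and 1/(j+1). The first bound
    keeps the game going. By the second, a set [U k] containing the limit point would have weight at
    most 1/(j+1) for all j, which is impossible as [v k] is positive. *)
Lemma playable_not_avoided s (P : nat -> R -> Prop) :
  0 < s -> (forall j, playable s (P j)) ->
  exists thr, 0 < thr /\ forall v U, cover_system s v U ->
    (forall N, sum_f_R0 v N <= thr) ->
    exists x, (forall j, P j x) /\ forall k, ~ U k x.
Proof.
  intros Hs H. apply choice_fun in H. destruct H as [thr H].
  exists (thr 0%nat). split; [apply (H 0%nat)|]. intros v U S Sv.
  set (Inv := fun j (p : R * R) => 0 <= fst p < snd p /\ snd p <= 1 /\
    load_le v U (fst p) (snd p) (thr j * Rpower (snd p - fst p) s)).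
  assert (Step : forall jp : nat * (R * R), exists p' : R * R, Inv (fst jp) (snd jp) ->
     Inv (Datatypes.S (fst jp)) p' /\
     fst (snd jp) <= fst p' /\ snd p' <= snd (snd jp) /\
     load_le v U (fst p') (snd p') (/ INR (fst jp + 1)) /\
     forall x, fst p' <= x <= snd p' -> P (fst jp) x).
  { intros [j [a b]]; simpl. destruct (classic (Inv j (a, b))) as [I|I].
    (* A dummy value: the claim is conditional on the invariant. *)
    2: { exists (0, 0). tauto. }
    destruct I as (I1 & I2 & I3); simpl in *.
    destruct (H j) as (Tj & Hj). destruct (H (Datatypes.S j)) as (Tj' & _).
    assert (Hi : 0 < / INR (j + 1)) by (apply Rinv_0_lt_compat, lt_0_INR; lia).
    destruct (Hj v U S a b I1 I2 I3 (Rmin (thr (Datatypes.S j)) (/ INR (j + 1))))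
      as (a' & b' & Ha' & Hb' & L' & P').
    { now apply Rmin_pos. }
    exists (a', b'). intros _. simpl. pose proof (Rpower_pos (b' - a') s).
    split; [|split; [lra|split; [lra|split; [|assumption]]]].
    - split; simpl; [lra|]. split; [lra|]. eapply load_le_weaken, L'.
      apply Rmult_le_compat_r; [lra | apply Rmin_l].
    - eapply load_le_weaken, L'.
      rewrite <- (Rmult_1_r (/ INR (j + 1))) at 2.
      apply Rmult_le_compat; [left; now apply Rmin_pos | lra | apply Rmin_r |].
      apply Rpower_le_1; lra. }
  apply choice_fun in Step. destruct Step as [F Step].
  set (p := nat_rect (fun _ => (R * R)%type) (0, 1) (fun j p => F (j, p))).
  assert (I : forall j, Inv j (p j)).
  { induction j as [|j IH]; [|now apply (Step (j, p j))].
    split; simpl; [lra|]. split; [lra|]. intros N.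
    rewrite Rminus_0_r, Rpower_base_1, Rmult_1_r. eapply Rle_trans; [|apply (Sv N)]. apply sum_Rle. intros k _.
    unfold touch_weight. destruct (S k). destruct (excluded_middle_informative _); lra. }
  assert (G := fun j => Step (j, p j) (I j)). simpl in G.
  destruct (nested_intervals (fun j => fst (p j)) (fun j => snd (p j))) as [x Hx].
  { intros j. destruct (G j) as (_ & G1 & G2 & _). destruct (I j) as (I1 & _).
    simpl. split; [exact G1|]. split; [exact G2|]. lra. }
  exists x. split.
  - intros j. apply (G j). apply (Hx (Datatypes.S j)).
  - intros k Uk. destruct (S k) as [Vk _].
    destruct (INR_unbounded (/ v k)) as [n Hn].
    destruct (G n) as (_ & _ & _ & L & _).
    assert (T : v k <= / INR (n + 1)).
    { eapply touched_weight_le; [apply S | apply L |]. exists x. split; [assumption|].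
      apply (Hx (Datatypes.S n)). }
    rewrite plus_INR in T. simpl in T.
    assert (0 < / v k) by now apply Rinv_0_lt_compat.
assert (C : / (INR n + 1) < / / v k)
      by (apply Rinv_lt_contravar; [apply Rmult_lt_0_compat|]; lra).
    rewrite Rinv_inv in C. lra.
Qed.

Lemma sum_geometric_half (eps : R) (N : nat) :
  0 < eps -> sum_f_R0 (fun k => eps * (1/2) ^ (k + 1)) N <= eps.
Proof.
  intros He. enough (E : sum_f_R0 (fun k => eps * (1/2) ^ (k + 1)) N
                         = eps - eps * (1/2) ^ (N + 1)).
  { rewrite E. pose proof (pow_lt (1/2) (N + 1)). nra. }
  induction N as [|N IH]; simpl; [field|]. rewrite IH. simpl. field.
Qed.

Lemma playable_not_null s (P : nat -> R -> Prop) :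
  0 < s -> (forall j, playable s (P j)) ->
  ~ hausdorff_null s (fun x => forall j, P j x).
Proof.
  intros Hs H N.
  destruct (playable_not_avoided s P Hs H) as (thr & Tp & A).
  destruct (N 1 (thr / 2)) as (U & d & Hd & Cov & Sd); [lra | lra |].
  (* The geometric term makes every weight positive, also for diameter 0; each of the two summands
     contributes at most [thr / 2] in total. *)
  set (v := fun k => pw (d k) s + thr / 2 * (1/2) ^ (k + 1)).
  assert (Pw : forall k, 0 <= pw (d k) s).
  { intros k. unfold pw. destruct (Rlt_dec 0 (d k)); [left; apply Rpower_pos | lra]. }
  assert (E : forall k, 0 < thr / 2 * (1/2) ^ (k + 1)).
  { intros k. apply Rmult_lt_0_compat; [lra | apply pow_lt; lra]. }
  destruct (A v U) as (x & Px & Ux).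
  - intros k. specialize (Pw k). specialize (E k). split; [unfold v; lra|].
    intros y z Uy Uz. destruct (Hd k) as [Dk Diam].
    eapply Rle_trans; [now apply Diam|].
    unfold v, pw in *. destruct (Rlt_dec 0 (d k)) as [L|L].
    + replace (d k) with (Rpower (Rpower (d k) s) (/ s)) at 1
        by (rewrite Rpower_mult, Rinv_r, Rpower_1; lra).
      apply Rle_Rpower_l; [left; now apply Rinv_0_lt_compat|].
      pose proof (Rpower_pos (d k) s). lra.
    + apply Rle_trans with 0; [lra | left; apply Rpower_pos].
  - intros n. unfold v. rewrite sum_plus.
    pose proof (sum_geometric_half (thr / 2) n). specialize (Sd n). lra.
  - destruct (Cov x Px) as [k Hk]. now apply (Ux k).
Qed.

(** * The upper bound: covering the unit interval by equal pieces *)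

Lemma sum_truncated_constant (c : R) (M N : nat) :
  0 <= c -> sum_f_R0 (fun k => if Nat.ltb k M then c else 0) N <= INR M * c.
Proof.
  intros Hc.
  enough (E : sum_f_R0 (fun k => if Nat.ltb k M then c else 0) N = INR (min (S N) M) * c).
  { rewrite E. apply Rmult_le_compat_r; [assumption | apply le_INR; lia]. }
  induction N as [|N IH].
  - simpl sum_f_R0. destruct M as [|M]; simpl; [ring|]. destruct M; simpl; ring.
  - rewrite tech5, IH. destruct (Nat.ltb_spec (S N) M).
    + rewrite !Nat.min_l by lia. rewrite (S_INR (S N)). ring.
    + rewrite !Nat.min_r by lia. ring.
Qed.

Lemma hausdorff_null_unit_interval (s : R) (E : R -> Prop) :
  1 < s -> (forall x, E x -> 0 <= x < 1) -> hausdorff_null s E.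
Proof.
  intros Hs HE delta eps Hd He.
  (* The pieces have length 1/M and cost M * M^-s = M^-(s-1). The three summands give M > 0, 1/M <=
     delta and M^-(s-1) <= eps. *)
  destruct (INR_unbounded (1 + / delta + / Rpower eps (/ (s - 1)))) as [M HM].
  assert (Pd : 0 < / delta) by now apply Rinv_0_lt_compat.
  assert (Pe : 0 < / Rpower eps (/ (s - 1))) by apply Rinv_0_lt_compat, Rpower_pos.
  assert (PM : 0 < INR M) by lra.
  assert (IM : 0 < / INR M) by now apply Rinv_0_lt_compat.
  assert (MM : INR M * / INR M = 1) by (apply Rinv_r; lra).
  exists (fun k x => (k < M)%nat /\ INR k * / INR M <= x <= (INR k + 1) * / INR M),
    (fun k => if Nat.ltb k M then / INR M else 0).
  split; [|split].
  - intros k. split.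
    + destruct (Nat.ltb k M); [|lra]. split; [lra|].
      rewrite <- (Rinv_inv delta). apply Rinv_le_contravar; lra.
    + intros x y [K Hx] [_ Hy]. apply Nat.ltb_lt in K. rewrite K.
      apply Rabs_le. lra.
  - intros x Ex. specialize (HE x Ex).
    destruct (archimed (x * INR M)) as [A1 A2].
    (* [up] is the least integer strictly above its argument, so this is the floor of x * M. *)
    set (k := Z.to_nat (up (x * INR M) - 1)).
    assert (0 < up (x * INR M))%Z by (apply lt_IZR; nra).
    assert (K : INR k = IZR (up (x * INR M)) - 1).
    { unfold k. rewrite INR_IZR_INZ, Z2Nat.id, minus_IZR by lia. reflexivity. }
    exists k. split; [apply INR_lt; nra|]. rewrite K.
    replace x with (x * INR M * / INR M) at 2 3 by (field; lra).
    split; apply Rmult_le_compat_r; lra.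
  - intros N. eapply Rle_trans.
    + apply Req_le, (sum_eq _ (fun k => if Nat.ltb k M then Rpower (/ INR M) s else 0)).
      intros k _. unfold pw. destruct (Nat.ltb k M); destruct (Rlt_dec _ _); lra.
    + eapply Rle_trans; [apply sum_truncated_constant; left; apply Rpower_pos|].
      replace s with (1 + (s - 1)) by ring.
      rewrite Rpower_plus, Rpower_1, <- Rmult_assoc, MM, Rmult_1_l by assumption.
      apply Rle_trans with (Rpower (Rpower eps (/ (s - 1))) (s - 1)).
      * apply Rle_Rpower_l; [lra|]. split; [assumption|].
        rewrite <- (Rinv_inv (Rpower eps _)). apply Rinv_le_contravar; lra.
      * rewrite Rpower_mult, Rinv_l, Rpower_1 by lra. lra.
Qed.

(** * Averaging the load over children *)

Definition list_sum_R (f : nat -> R) (W : list nat) : R :=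
  fold_right (fun i acc => f i + acc) 0 W.

Lemma list_sum_R_exchange (f : nat -> nat -> R) (W : list nat) (N : nat) :
  list_sum_R (fun i => sum_f_R0 (f i) N) W
  = sum_f_R0 (fun k => list_sum_R (fun i => f i k) W) N.
Proof.
  induction W as [|i W IH]; simpl.
  - rewrite sum_cte. ring.
  - rewrite IH. symmetry. apply (sum_plus (f i)).
Qed.

Lemma list_sum_R_gt (f : nat -> R) (t : R) (W : list nat) :
  W <> [] -> (forall i, In i W -> t < f i) -> INR (length W) * t < list_sum_R f W.
Proof.
  induction W as [|i W IH]; intros NE H; [easy|].
  assert (Hi : t < f i) by (apply H; now left).
  change (INR (S (length W)) * t < f i + list_sum_R f W).
  rewrite S_INR. destruct W as [|i' W]; [simpl; lra|].
  assert (I : INR (length (i' :: W)) * t < list_sum_R f (i' :: W)).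
  { apply IH; [easy|]. intros; apply H; now right. }
  lra.
Qed.

Lemma sum_f_R0_le_N (f : nat -> R) (M N : nat) :
  (forall k, 0 <= f k) -> (M <= N)%nat -> sum_f_R0 f M <= sum_f_R0 f N.
Proof.
  intros P L. induction L as [|N L IH]; [lra|]. simpl. specialize (P (S N)). lra.
Qed.

Lemma list_sum_touch_weight (v : nat -> R) (U : nat -> R -> Prop) lo hi k W :
  let W' := filter (fun i => if excluded_middle_informative (touches (U k) (lo i) (hi i))
                             then true else false) W in
  list_sum_R (fun i => touch_weight v U (lo i) (hi i) k) W = INR (length W') * v k.
Proof.
  simpl. induction W as [|i W IH]; [simpl; ring|].
  change (touch_weight v U (lo i) (hi i) k
          + list_sum_R (fun i => touch_weight v U (lo i) (hi i) k) W
          = INR (length (filter (fun i => if excluded_middle_informative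
                (touches (U k) (lo i) (hi i)) then true else false) (i :: W))) * v k).
  rewrite IH. unfold touch_weight. simpl.
  destruct (excluded_middle_informative (touches (U k) (lo i) (hi i))).
  - simpl length. rewrite S_INR. ring.
  - ring.
Qed.

(* Averaging: each covering set meets at most seven of the children, so some
   child carries at most the fraction 7 / |W| of the load. *)
Lemma light_child s v U a b t (W : list nat) (lo hi : nat -> R) :
  cover_system s v U -> NoDup W -> W <> [] ->
  (forall i, In i W -> a <= lo i /\ hi i <= b) ->
  (forall k i j, In i W -> In j W -> touches (U k) (lo i) (hi i) ->
     touches (U k) (lo j) (hi j) -> (j <= i + 3)%nat) ->
  load_le v U a b t ->
  exists i, In i W /\ load_le v U (lo i) (hi i) (7 * t / INR (length W)).
Proof.
  intros S ND NE Sub Sep L.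
  apply NNPP. intros C.
  set (t' := 7 * t / INR (length W)) in *.
  (* Partial sums increase and [W] is finite, so one index [N] witnesses the overload of all
     children at once. *)
  assert (Heavy : exists N, forall i, In i W -> t' < sum_f_R0 (touch_weight v U (lo i) (hi i)) N).
  { assert (C' : forall i, In i W -> ~ load_le v U (lo i) (hi i) t') by eauto.
    clearbody t'. clear - C' S. induction W as [|i W IH]; [now exists 0%nat|].
    destruct IH as [N HN]; [intros; apply C'; now right|].
    assert (Ci := C' i (or_introl eq_refl)).
    apply not_all_ex_not in Ci. destruct Ci as [M HM].
    exists (max M N). intros j [<-|Hj].
    - eapply Rlt_le_trans; [apply Rnot_le_lt, HM|].
      apply sum_f_R0_le_N; [intros; eapply touch_weight_nonneg, S | lia].
    - eapply Rlt_le_trans; [apply HN, Hj|].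
      apply sum_f_R0_le_N; [intros; eapply touch_weight_nonneg, S | lia]. }
  destruct Heavy as [N HN].
  apply list_sum_R_gt in HN; [|assumption].
  rewrite list_sum_R_exchange in HN.
  assert (LW : 0 < INR (length W)).
  { apply lt_0_INR. destruct W; [easy | simpl; lia]. }
  assert (Up : sum_f_R0 (fun k => list_sum_R (fun i => touch_weight v U (lo i) (hi i) k) W) N
               <= 7 * sum_f_R0 (touch_weight v U a b) N).
  { rewrite scal_sum. apply sum_Rle. intros k _.
    rewrite list_sum_touch_weight.
    set (W' := filter _ W).
    assert (IW : forall i, In i W' -> In i W /\ touches (U k) (lo i) (hi i)).
    { intros i Hi. apply filter_In in Hi. destruct Hi as [I1 I2]. split; [assumption|].
      destruct (excluded_middle_informative _); easy. }
    assert (NW : NoDup W') by now apply NoDup_filter.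
    destruct W' as [|i0 W''] eqn:EW.
    - simpl. pose proof (touch_weight_nonneg s v U a b k S). lra.
    - rewrite <- EW in *.
      assert (I0 : In i0 W') by (rewrite EW; now left).
      destruct (IW i0 I0) as [I1 T0].
      (* All touched indices lie within distance 3 of [i0], hence in a window of seven integers. *)
      assert (Len : (length W' <= 7)%nat).
      { rewrite <- (length_seq 7 (i0 - 3)). apply NoDup_incl_length; [assumption|].
        intros j Hj. destruct (IW j Hj) as [J1 Tj]. apply in_seq.
        pose proof (Sep k i0 j I1 J1 T0 Tj). pose proof (Sep k j i0 J1 I1 Tj T0). lia. }
      assert (T : touches (U k) a b).
      { destruct T0 as (x & Ux & Hx). exists x. destruct (Sub i0 I1). split; [assumption | lra]. }
      unfold touch_weight. destruct (excluded_middle_informative _); [|contradiction].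
      apply le_INR in Len. simpl INR at 2 in Len. destruct (S k). nra. }
  specialize (L N).
  assert (E : INR (length W) * t' = 7 * t) by (unfold t'; field; lra).
  lra.
Qed.

(** * Counting occurrences of a word *)

(** Unlike [tau], this counts all starting positions below [n], even if the occurrence runs past
    [n]. The gain is exact additivity along the orbit. *)
Definition visits (beta : R) (w : list nat) (x : R) (n : nat) : nat :=
  length (filter (fun i => if list_eq_dec Nat.eq_dec (block beta x i (length w)) w
                           then true else false) (seq 0 n)).

Lemma visits_S beta w x n :
  visits beta w x (S n) = (visits beta w x n +
    if list_eq_dec Nat.eq_dec (block beta x n (length w)) w then 1 else 0)%nat.
Proof.
  unfold visits. rewrite seq_S, filter_app, length_app. simpl.
  destruct (list_eq_dec Nat.eq_dec (block beta x n (length w)) w); reflexivity.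
Qed.

Lemma visits_add beta w x a b :
  visits beta w x (a + b)
  = (visits beta w x a + visits beta w (Nat.iter a (fbeta beta) x) b)%nat.
Proof.
  induction b as [|b IH]; [rewrite Nat.add_0_r; unfold visits at 3; simpl; lia|].
  rewrite Nat.add_succ_r, !visits_S, IH, block_iter. lia.
Qed.

Lemma visits_le beta w x n : (visits beta w x n <= n)%nat.
Proof.
  unfold visits. etransitivity; [apply filter_length_le|]. now rewrite length_seq.
Qed.

Lemma visits_tau beta w x n :
  (tau beta w x n <= visits beta w x n <= tau beta w x n + length w)%nat.
Proof.
  change (tau beta w x n) with (visits beta w x (n - length w)).
  destruct (Nat.le_ge_cases (length w) n) as [L|L].
  - replace n with ((n - length w) + length w)%nat at 2 3 by lia.
    rewrite visits_add.
    pose proof (visits_le beta w (Nat.iter (n - length w) (fbeta beta) x) (length w)). lia.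
  - replace (n - length w)%nat with 0%nat by lia.
    change (visits beta w x 0) with 0%nat. pose proof (visits_le beta w x n). lia.
Qed.

Lemma nth_block beta x n j : (j < n)%nat -> nth j (block beta x 0 n) 0%nat = digit beta x j.
Proof.
  intros H. unfold block.
  rewrite nth_indep with (d' := (fun k => digit beta x (0 + k)) 0%nat)
    by (rewrite length_map, length_seq; lia).
  rewrite (map_nth (fun k => digit beta x (0 + k))), seq_nth by assumption. reflexivity.
Qed.

Lemma block_prefix_eq beta x y n i m :
  block beta x 0 n = block beta y 0 n -> (i + m <= n)%nat ->
  block beta x i m = block beta y i m.
Proof.
  intros E L. unfold block. apply map_ext_in. intros k Hk. apply in_seq in Hk.
  rewrite <- !(nth_block beta _ n) by lia. now rewrite E.
Qed.

(** This locality fails for [visits], and is why words are sorted by [tau] in the pigeonhole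
    argument: the count is constant on a cylinder. *)
Lemma tau_prefix_eq beta w x y n :
  block beta x 0 n = block beta y 0 n -> tau beta w x n = tau beta w y n.
Proof.
  intros E. unfold tau. f_equal. apply filter_ext_in. intros i Hi. apply in_seq in Hi.
  now rewrite (block_prefix_eq beta x y n) by (assumption || lia).
Qed.

Lemma block_app_inv beta x (u v : list nat) n :
  block beta x 0 (length u + n) = u ++ v ->
  block beta x 0 (length u) = u /\
  block beta (Nat.iter (length u) (fbeta beta) x) 0 n = v.
Proof.
  intros E. rewrite block_add, (Nat.add_comm 0), block_iter in E.

  assert (L : length (block beta x 0 (length u)) = length u) by apply block_length.
  set (p := block beta x 0 (length u)) in *.
  apply (f_equal (firstn (length u))) in E as E1.
  apply (f_equal (skipn (length u))) in E as E2.
  rewrite <- L in E1 at 1. rewrite <- L in E2 at 1.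
  rewrite !firstn_app, !skipn_app, !Nat.sub_diag, !firstn_all, !skipn_all, !skipn_O,
    !firstn_O, !app_nil_r in *.
  simpl in *. auto.
Qed.

Lemma visits_repeat beta w (b : list nat) (lo hi : nat) :
  1 < beta ->
  (forall y, 0 <= y < 1 -> block beta y 0 (length b) = b ->
     (lo <= visits beta w y (length b) <= hi)%nat) ->
  forall t y, 0 <= y < 1 ->
    block beta y 0 (t * length b) = concat (repeat b t) ->
    (t * lo <= visits beta w y (t * length b) <= t * hi)%nat.
Proof.
  intros Hb H. induction t as [|t IH]; intros y Hy E.
  - unfold visits. simpl. lia.
  - simpl in *. apply block_app_inv in E. destruct E as [E1 E2].
    rewrite visits_add. specialize (H y Hy E1).
    specialize (IH _ (iter_fbeta_bounds beta y (length b) Hy) E2). lia.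
Qed.

Lemma full_repeat beta (b : list nat) t :
  1 < beta -> opens beta b 1 -> opens beta (concat (repeat b t)) 1.
Proof.
  intros Hb O. induction t; simpl; [apply opens_nil | now apply full_app].
Qed.

Lemma length_concat_repeat (b : list nat) t :
  length (concat (repeat b t)) = (t * length b)%nat.
Proof. induction t; simpl; [reflexivity | rewrite length_app, IHt; reflexivity]. Qed.

Lemma block_of_zeros beta y L i m :
  block beta y 0 L = repeat 0%nat L -> (i + m <= L)%nat ->
  block beta y i m = repeat 0%nat m.
Proof.
  intros E H. rewrite <- (length_seq m 0) at 2. rewrite <- (map_const 0%nat (seq 0 m)).
  apply map_ext_in. intros k Hk. apply in_seq in Hk.
  rewrite <- (nth_block beta y L) by lia. rewrite E. apply nth_repeat.
Qed.

Lemma tau_zeros_const beta w y L :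
  w = repeat 0%nat (length w) -> block beta y 0 L = repeat 0%nat L ->
  tau beta w y L = (L - length w)%nat.
Proof.
  intros Ew E. change (visits beta w y (L - length w) = (L - length w)%nat).
  assert (H : forall n, (n <= L - length w)%nat -> visits beta w y n = n).
  { induction n as [|n IH]; intros Hn; [reflexivity|].
    rewrite visits_S, IH by lia.
    rewrite (block_of_zeros beta y L) by (assumption || lia).
    destruct (list_eq_dec _ _ _); [lia | congruence]. }
  now apply H.
Qed.

Lemma tau_zeros_other beta w y L :
  w <> repeat 0%nat (length w) -> block beta y 0 L = repeat 0%nat L ->
  tau beta w y L = 0%nat.
Proof.
  intros Ew E. change (visits beta w y (L - length w) = 0%nat).
  assert (H : forall n, (n <= L - length w)%nat -> visits beta w y n = 0%nat).
  { induction n as [|n IH]; intros Hn; [reflexivity|].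
    rewrite visits_S, IH by lia.
    rewrite (block_of_zeros beta y L) by (assumption || lia).
    destruct (list_eq_dec _ _ _); [congruence | lia]. }
  now apply H.
Qed.

(* The gap exceeds |w|, the possible number of occurrences straddling the end of a block. *)
Lemma contrasting_words beta w :
  1 < beta < 2 -> expansion_of_one_terminates beta ->
  (1 <= length w)%nat -> admissible_word beta w ->
  exists v1 v2 B, opens beta v1 1 /\ opens beta v2 1 /\ length v1 = length v2 /\
    (forall y, 0 <= y < 1 -> block beta y 0 (length v1) = v1 ->
       (visits beta w y (length v1) <= B)%nat) /\
    (forall y, 0 <= y < 1 -> block beta y 0 (length v2) = v2 ->
       (B + length w + 1 <= visits beta w y (length v2))%nat).
Proof.
  intros Hb Ht Lw (y0 & Hy0 & i0 & Ew).
  destruct (padding beta Hb Ht) as [z Hz].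
  (* Passing between [tau] and [visits] costs at most m; with 2m+1 repetitions a gap of m+1
     remains. *)
  set (m := length w) in *. set (t := (2 * m + 1)%nat).
  destruct (list_eq_dec Nat.eq_dec w (repeat 0%nat m)) as [W0|W0].
  (* If [w] consists of zeros, it is rare in repetitions of 1 0^z, as no occurrence starts at the
     digit 1, and frequent in a run of zeros. The word [b] is full because 1/beta has first digit
     1. *)
  - set (b := 1%nat :: repeat 0%nat z).
    assert (Hbeta1 : 0 <= / beta < 1).
    { split; [left; apply Rinv_0_lt_compat; lra|].
      rewrite <- Rinv_1. apply Rinv_lt_contravar; lra. }
    assert (Ob : opens beta b 1).
    { destruct (Hz (/ beta) 1%nat Hbeta1) as [O _].
      replace (block beta (/ beta) 0 1) with [1%nat] in O; [exact O|].
      cbn. f_equal. symmetry. apply (digit_one beta (/ beta)); [reflexivity|].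
      rewrite Rinv_r; lra. }
    assert (Vb : forall y, 0 <= y < 1 -> block beta y 0 (length b) = b ->
               (0 <= visits beta w y (length b) <= z)%nat).
    { intros y Hy E. split; [lia|].
      change (length b) with (1 + length (repeat 0%nat z))%nat.
      rewrite visits_add, visits_S.
      pose proof (visits_le beta w (Nat.iter 1 (fbeta beta) y) (length (repeat 0%nat z))) as V.
      rewrite repeat_length in *.
      destruct (list_eq_dec Nat.eq_dec (block beta y 0 (length w)) w) as [F|F].
      - exfalso. fold m in F. rewrite W0 in F.
        apply (f_equal (fun l => nth 0 l 0%nat)) in F. apply (f_equal (fun l => nth 0 l 0%nat)) in E.
        rewrite nth_repeat, nth_block in F by lia. rewrite nth_block in E by (simpl; lia).
        simpl in E. congruence.
      - unfold visits at 1. simpl seq. simpl filter. simpl length. lia. }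
    assert (Lb : length b = S z) by (simpl; now rewrite repeat_length).
    exists (concat (repeat b t)), (repeat 0%nat (t * length b)), (t * z)%nat.
    rewrite length_concat_repeat, repeat_length.
    split; [apply full_repeat; [lra | assumption]|].
    split; [apply full_zeros; lra|]. split; [reflexivity|]. split.
    + intros y Hy E. apply (visits_repeat beta w b 0 z); [lra | assumption..].
    + intros y Hy E. apply tau_zeros_const with (w := w) in E; [|exact W0].
      pose proof (visits_tau beta w y (t * length b)) as V. rewrite E in V.
      rewrite Lb in *. fold m in V. unfold t in *. nia.
  - set (x0 := Nat.iter i0 (fbeta beta) y0).
    assert (Hx0 : 0 <= x0 < 1) by now apply iter_fbeta_bounds.
    assert (Ew' : block beta x0 0 m = w).
    { unfold x0. rewrite <- block_iter, Nat.add_0_r. exact Ew. }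
    (* Otherwise [w] is absent from runs of zeros and starts every copy of [b], which is full
       because [w] begins the expansion of [x0]. *)
    set (b := w ++ repeat 0%nat z).
    assert (Ob : opens beta b 1).
    { destruct (Hz x0 m Hx0) as [O _]. rewrite Ew' in O. exact O. }
    assert (Lb : length b = (m + z)%nat) by (unfold b; now rewrite length_app, repeat_length).
    assert (Vb : forall y, 0 <= y < 1 -> block beta y 0 (length b) = b ->
               (1 <= visits beta w y (length b) <= length b)%nat).
    { intros y Hy E. split; [|apply visits_le].
      rewrite Lb in E. apply block_app_inv in E. destruct E as [E _].
      replace (length b) with (1 + (length b - 1))%nat by lia.
      rewrite visits_add, visits_S, E.
      destruct (list_eq_dec Nat.eq_dec w w); [lia | congruence]. }
    exists (repeat 0%nat (t * length b)), (concat (repeat b t)), m.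
    rewrite length_concat_repeat, repeat_length.
    split; [apply full_zeros; lra|].
    split; [apply full_repeat; [lra | assumption]|]. split; [reflexivity|]. split.
    + intros y Hy E. apply tau_zeros_other with (w := w) in E; [|exact W0].
      pose proof (visits_tau beta w y (t * length b)) as V. rewrite E in V. fold m in V. lia.
    + intros y Hy E.
      assert (V : (t * 1 <= visits beta w y (t * length b) <= t * length b)%nat).
      { apply visits_repeat; [lra | assumption..]. }
      unfold t in *. lia.
Qed.

Lemma pigeonhole_fibre (f : nat -> nat) (K : nat) (l : list nat) :
  (forall i, In i l -> (f i < K)%nat) ->
  exists N, (length l <= K * length (filter (fun i => Nat.eqb (f i) N) l))%nat.
Proof.
  revert l. induction K as [|K IH]; intros l H.
  - exists 0%nat. destruct l as [|i l]; [simpl; lia|]. specialize (H i (or_introl eq_refl)). lia.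
  - pose proof (filter_length (fun i => Nat.eqb (f i) K) l) as P.
    destruct (IH (filter (fun i => negb (Nat.eqb (f i) K)) l)) as [N HN].
    { intros i Hi. apply filter_In in Hi. destruct Hi as [Hi E].
      apply Bool.negb_true_iff, Nat.eqb_neq in E. specialize (H i Hi). lia. }
    assert (Mon : (length (filter (fun i => Nat.eqb (f i) N)
                    (filter (fun i => negb (Nat.eqb (f i) K)) l))
                   <= length (filter (fun i => Nat.eqb (f i) N) l))%nat).
    { clear. induction l as [|i l IH]; [simpl; lia|]. simpl.
      destruct (Nat.eqb (f i) K); simpl; destruct (Nat.eqb (f i) N); simpl; lia. }
    set (cK := length (filter (fun i => Nat.eqb (f i) K) l)) in *.
    set (cN := length (filter (fun i => Nat.eqb (f i) N) l)) in *.
    destruct (Nat.le_ge_cases cK cN).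
    + exists N. fold cN. nia.
    + exists K. fold cK. nia.
Qed.

(** * Playing with blocks of prescribed frequency *)

(* The blocks [h i], i in W, lie close to the points i / beta^q, so that a set
   of diameter at most beta^-q meets few of their cylinders. *)
Definition branching (beta s : R) (w : list nat) (h : nat -> list nat) (W : list nat)
    (q H lo hi : nat) : Prop :=
  NoDup W /\
  (forall i, In i W ->
     length (h i) = H /\ inner beta (h i) /\
     INR i - 1 <= beta ^ q * point beta (h i) 0 /\
     beta ^ q * point beta (h i) 1 <= INR i + 1 /\
     forall y, 0 <= y < 1 -> block beta y 0 H = h i ->
       (lo <= visits beta w y H <= hi)%nat) /\
  14 * Rpower (beta ^ H) s <= INR (length W).

Lemma point_affine beta u y : point beta u y = point beta u 0 + y * / beta ^ length u.
Proof. unfold point, Rdiv. ring. Qed.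

(** The game uses closed intervals, but [opens] only controls parameters below 1. Since [h] is
    inner, its closed cylinder ends strictly before 1, so its image under the branch of [G] lies in
    the half-open cylinder of [G]. *)
Lemma full_of_inner_child beta G h x :
  1 < beta -> opens beta G 1 -> inner beta h ->
  point beta (G ++ h) 0 <= x <= point beta (G ++ h) 1 ->
  0 <= x < 1 /\ block beta x 0 (length G) = G.
Proof.
  intros Hb O [Oh Ih] Hx. rewrite !point_app in Hx by assumption.
  destruct (full_point_le beta h Hb Oh) as [H0 _].
  assert (P : 0 < beta ^ length G) by (apply pow_lt; lra).
  assert (Pi : 0 < / beta ^ length G) by now apply Rinv_0_lt_compat.
  set (y := (x - point beta G 0) * beta ^ length G).
  assert (E : point beta G y = x).
  { rewrite point_affine. unfold y. field. lra. }
  assert (Y : 0 <= y < 1).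
  { split.
    - destruct (Rle_lt_dec 0 y) as [|L]; [assumption|].
      pose proof (point_mono_strict beta y (point beta h 0) G Hb ltac:(lra)). lra.
    - destruct (Rlt_le_dec y 1) as [|L]; [assumption|].
      pose proof (point_mono_strict beta (point beta h 1) y G Hb ltac:(lra)). lra. }
  destruct (O y Y) as (O1 & _ & O3). rewrite E in *. auto.
Qed.

(** [light_child] gives the fraction 7 / |W| of the load, and |W| >= 14 * beta^(H*s) turns this into
    half of the load relative to the child's length to the power s. *)
Lemma branching_step beta s w h W q H lo hi v U G c :
  1 < beta -> 0 < s -> branching beta s w h W q H lo hi -> cover_system s v U ->
  opens beta G 1 -> 0 <= c <= Rpower (/ beta ^ q) s ->
  load_le v U (point beta G 0) (point beta G 1) (c * Rpower (/ beta ^ length G) s) ->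
  exists i, In i W /\
    load_le v U (point beta (G ++ h i) 0) (point beta (G ++ h i) 1)
      (c / 2 * Rpower (/ beta ^ (length G + H)) s).
Proof.
  intros Hb Hs (ND & BW & Card) S O Hc L.
  set (lam := / beta ^ length G) in *.
  assert (Plam : 0 < lam) by (apply Rinv_0_lt_compat, pow_lt; lra).
  assert (Pq : 0 < beta ^ q) by (apply pow_lt; lra).
  assert (PH : 0 < beta ^ H) by (apply pow_lt; lra).
  assert (Piq : 0 < / beta ^ q) by now apply Rinv_0_lt_compat.
  assert (Eq : beta ^ q * / beta ^ q = 1) by (apply Rinv_r; lra).
  pose proof (Rpower_pos (beta ^ H) s) as RH.
  destruct (light_child s v U (point beta G 0) (point beta G 1) (c * Rpower lam s) W
     (fun i => point beta (G ++ h i) 0) (fun i => point beta (G ++ h i) 1)) as (i & Hi & Li).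
  - assumption.
  - assumption.
  - intros ->. simpl in Card. lra.
  - intros i Hi. destruct (BW i Hi) as (_ & [Oi _] & _).
    destruct (full_point_le beta (h i) Hb Oi).
    rewrite !point_app by assumption. split; apply point_mono; assumption.
  - intros k i j Hi Hj (x & Ux & Hx) (x' & Ux' & Hx').
    (* A set touching a child weighs at most the whole load; the size bound on [c] then limits its
       diameter to beta^-q times the length of the cylinder of [G]. *)
    assert (Tk : v k <= Rpower (lam * / beta ^ q) s).
    { apply Rle_trans with (c * Rpower lam s).
      - eapply touched_weight_le; [exact S | exact L |].
        exists x. split; [assumption|].
        destruct (BW i Hi) as (_ & [Oi _] & _).
        destruct (full_point_le beta (h i) Hb Oi) as [F0 F1].
        rewrite !point_app in Hx by assumption.
        pose proof (point_mono beta _ _ G Hb F0). pose proof (point_mono beta _ _ G Hb F1). lra.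
      - rewrite <- Rpower_mult_distr by assumption. rewrite Rmult_comm.
        apply Rmult_le_compat_l; [left; apply Rpower_pos | lra]. }
    destruct (S k) as [Vk Dk].
    assert (D : Rabs (x' - x) <= lam * / beta ^ q).
    { eapply Rle_trans; [now apply Dk|].
      apply Rle_trans with (Rpower (Rpower (lam * / beta ^ q) s) (/ s)).
      - apply Rle_Rpower_l; [left; now apply Rinv_0_lt_compat | lra].
      - rewrite Rpower_mult, Rinv_r, Rpower_1; [lra | now apply Rmult_lt_0_compat | lra]. }
    pose proof (Rle_abs (x' - x)).
    destruct (BW i Hi) as (_ & _ & _ & Bi & _). destruct (BW j Hj) as (_ & _ & Bj & _).
    rewrite !point_app, (point_affine beta G) in Hx, Hx' by assumption.
    rewrite (point_affine beta G (point beta (h i) 1)) in Hx.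
    rewrite (point_affine beta G (point beta (h j) 1)) in Hx'. fold lam in Hx, Hx'.
    set (p := point beta (h i) 1) in *. set (p' := point beta (h j) 0) in *.
    assert (C1 : p' * lam - p * lam <= lam * / beta ^ q) by lra.
    assert (C2 : p' - p <= / beta ^ q) by (apply Rmult_le_reg_l with lam; lra).
    assert (C3 : beta ^ q * p' - beta ^ q * p <= 1).
    { rewrite <- Eq, <- Rmult_minus_distr_l. apply Rmult_le_compat_l; lra. }
    (* In units of beta^-q, the diameter contributes 1 and the deviation of each of the two children
       from its grid point contributes 1. *)
    apply INR_le. rewrite plus_INR. simpl (INR 3). lra.
  - exact L.
  - exists i. split; [assumption|]. eapply load_le_weaken, Li.
    rewrite pow_add, Rinv_mult, <- Rpower_mult_distr; fold lam;
      [|assumption | now apply Rinv_0_lt_compat].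
    assert (Einv : Rpower (/ beta ^ H) s = / Rpower (beta ^ H) s).
    { unfold Rpower. rewrite ln_Rinv, <- exp_Ropp by assumption. f_equal. ring. }
    rewrite Einv.
    pose proof (Rpower_pos lam s) as Rl.
    set (a := Rpower (beta ^ H) s) in *. set (b := Rpower lam s) in *.
    assert (Q : / INR (length W) <= / (14 * a)) by (apply Rinv_le_contravar; lra).
    unfold Rdiv.
    apply Rle_trans with (7 * (c * b) * / (14 * a)).
    + apply Rmult_le_compat_l; [nra | assumption].
    + right. field. lra.
Qed.

(** Each move halves the relative load, so the size bound on [c] persists. Nothing is known about
    the digits of [G], which add between 0 and |G| visits. *)
Lemma branching_iterate beta s w h W q H lo hi v U G c r :
  1 < beta -> 0 < s -> branching beta s w h W q H lo hi -> cover_system s v U ->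
  opens beta G 1 -> 0 <= c <= Rpower (/ beta ^ q) s ->
  load_le v U (point beta G 0) (point beta G 1) (c * Rpower (/ beta ^ length G) s) ->
  exists G', opens beta G' 1 /\ length G' = (length G + r * H)%nat /\
    point beta G 0 <= point beta G' 0 /\ point beta G' 1 <= point beta G 1 /\
    load_le v U (point beta G' 0) (point beta G' 1)
      (c / 2 ^ r * Rpower (/ beta ^ length G') s) /\
    forall x, 0 <= x < 1 -> block beta x 0 (length G') = G' ->
      (r * lo <= visits beta w x (length G') <= length G + r * hi)%nat.
Proof.
  intros Hb Hs B S O Hc L. induction r as [|r (G' & O' & LG & P0 & P1 & L' & V)].
  - exists G. simpl. rewrite Nat.add_0_r.
    replace (c / 1) with c by field.
    split; [assumption|]. split; [reflexivity|]. split; [lra|]. split; [lra|].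
    split; [assumption|]. intros x _ _.
    pose proof (visits_le beta w x (length G)). lia.
  - assert (P2 : 1 <= 2 ^ r) by (apply pow_R1_Rle; lra).
    destruct (branching_step beta s w h W q H lo hi v U G' (c / 2 ^ r) Hb Hs B S O')
      as (i & Hi & Li).
    + split.
      * apply Rmult_le_pos; [lra | left; apply Rinv_0_lt_compat; lra].
      * apply Rle_trans with (c / 1).
        -- apply Rmult_le_compat_l; [lra | apply Rinv_le_contravar; lra].
        -- lra.
    + exact L'.
    + destruct B as (_ & BW & _). destruct (BW i Hi) as (Lh & [Oh Ih] & _ & _ & Vh).
      destruct (full_point_le beta (h i) Hb Oh) as [F0 F1].
      pose proof (point_mono beta _ _ G' Hb F0). pose proof (point_mono beta _ _ G' Hb F1).
      exists (G' ++ h i).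
      assert (LGh : length (G' ++ h i) = (length G' + H)%nat)
        by (rewrite length_app; lia).
      split; [now apply full_app|]. split; [rewrite LGh, LG; simpl; lia|].
      rewrite !point_app in * by assumption. split; [lra|]. split; [lra|]. split.
      * rewrite LGh. replace (c / 2 ^ Datatypes.S r) with (c / 2 ^ r / 2).
        -- exact Li.
        -- simpl. field. lra.
      * intros x Hx E. rewrite LGh in E. apply block_app_inv in E. destruct E as [E1 E2].
        rewrite LGh, visits_add. specialize (V x Hx E1).
        specialize (Vh _ (iter_fbeta_bounds beta x (length G') Hx) E2). simpl. lia.
Qed.

Lemma pow_bracket (beta y : R) : 1 < beta -> 1 <= y -> exists n, y <= beta ^ n <= beta * y.
Proof.
  intros Hb Hy. destruct (pow_exceeds beta y Hb) as [N HN].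
  induction N as [|N IH]; [simpl in HN; lra|].
  destruct (Rlt_le_dec y (beta ^ N)) as [L|L]; [now apply IH|].
  exists (S N). split; [lra|]. simpl. apply Rmult_le_compat_l; lra.
Qed.

Lemma block_point_bounds beta x q :
  1 < beta < 2 -> 0 <= x < 1 ->
  point beta (block beta x 0 q) 0 <= x < point beta (block beta x 0 q) 1.
Proof.
  intros Hb Hx. destruct (follower_set beta x q Hb Hx) as (c & _ & _ & _ & E).
  pose proof (iter_fbeta_bounds beta x q Hx). rewrite <- E at 2 3. split.
  - apply point_mono; lra.
  - apply point_mono_strict; lra.
Qed.

(** The order-q cylinder of the midpoint fits once beta^-q <= (b - a) / 2. Choosing q within a
    factor beta of this bound, with beta < 2, and padding by [z] zeros gives the constant 4 *
    beta^z. *)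
Lemma full_cylinder_in_interval beta z a b :
  1 < beta < 2 ->
  (forall x q, 0 <= x < 1 -> inner beta (block beta x 0 q ++ repeat 0%nat z)) ->
  0 <= a < b -> b <= 1 ->
  exists G, opens beta G 1 /\ a <= point beta G 0 /\ point beta G 1 <= b /\
    b - a <= 4 * beta ^ z * / beta ^ length G.
Proof.
  intros Hb Hz Ha Hb1.
  destruct (pow_bracket beta (2 / (b - a))) as [q Hq]; [lra | |].
  { apply Rmult_le_reg_r with (b - a); [lra|].
    unfold Rdiv. rewrite Rmult_assoc, Rinv_l by lra. lra. }
  set (x := (a + b) / 2).
  assert (Hx : 0 <= x < 1) by (unfold x; lra).
  destruct (Hz x q Hx) as [O _].
  exists (block beta x 0 q ++ repeat 0%nat z). split; [assumption|].
  pose proof (block_point_bounds beta x q Hb Hx) as Bd.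
  rewrite (point_affine _ _ 1), block_length in Bd.
  rewrite !point_app by lra.
  destruct (full_point_le beta (repeat 0%nat z)) as [F0 F1]; [lra | apply full_zeros; lra |].
  apply (point_mono beta _ _ (block beta x 0 q)) in F0; [|lra].
  apply (point_mono beta _ _ (block beta x 0 q)) in F1; [|lra].
  rewrite (point_affine _ (block beta x 0 q) 1), block_length in F1.
  assert (Pq : 0 < beta ^ q) by (apply pow_lt; lra).
  assert (Pz : 0 < beta ^ z) by (apply pow_lt; lra).
  assert (D : 1 * / beta ^ q <= (b - a) / 2).
  { rewrite Rmult_1_l. replace ((b - a) / 2) with (/ (2 / (b - a))) by (field; lra).
    apply Rinv_le_contravar; [|lra]. apply Rmult_lt_0_compat; [lra | apply Rinv_0_lt_compat; lra]. }
  split; [unfold x in *; lra|]. split; [unfold x in *; lra|].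
  rewrite length_app, block_length, repeat_length, pow_add, Rinv_mult.
  replace (4 * beta ^ z * (/ beta ^ q * / beta ^ z)) with (4 * / beta ^ q) by (field; lra).
  apply Rmult_le_reg_r with (beta ^ q); [assumption|].
  rewrite Rmult_assoc, Rinv_l by lra.
  apply Rle_trans with ((b - a) * (beta * (2 / (b - a)))).
  - apply Rmult_le_compat_l; lra.
  - replace ((b - a) * (beta * (2 / (b - a)))) with (2 * beta) by (field; lra). lra.
Qed.

(** The variable [g] is the length of the uncontrolled prefix leading into the given interval; [r0]
    may depend on it, so the prefix can be diluted. Entering a full cylinder costs a factor K^s <=
    K, which the threshold absorbs. *)
Lemma playable_branching beta s w h W q H lo hi (Q : R -> Prop) :
  1 < beta < 2 -> expansion_of_one_terminates beta -> 0 < s < 1 ->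
  branching beta s w h W q H lo hi ->
  (forall g, exists r0, forall r, (r0 <= r)%nat -> forall x, 0 <= x < 1 ->
     (r * lo <= visits beta w x (g + r * H) <= g + r * hi)%nat -> Q x) ->
  playable s Q.
Proof.
  intros Hb Ht Hs B HQ. destruct (padding beta Hb Ht) as [z Hz].
  assert (Pz : 1 <= beta ^ z) by (apply pow_R1_Rle; lra).
  pose proof (Rpower_pos (/ beta ^ q) s) as Pq.
  set (K := 4 * beta ^ z) in *.
  assert (PK : 4 <= K) by (unfold K; lra).
  exists (Rpower (/ beta ^ q) s / K). split.
  { apply Rmult_lt_0_compat; [assumption | apply Rinv_0_lt_compat; lra]. }
  intros v U S a b Ha Hb1 L cs Hcs.
  destruct (full_cylinder_in_interval beta z a b Hb Hz Ha Hb1) as (G & O & A0 & A1 & Len).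
  fold K in Len.
  assert (PG : 0 < / beta ^ length G) by (apply Rinv_0_lt_compat, pow_lt; lra).
  set (c := Rpower (/ beta ^ q) s) in *.
  assert (L1 : load_le v U (point beta G 0) (point beta G 1) (c * Rpower (/ beta ^ length G) s)).
  { eapply load_le_mono; [exact S | exact A0 | exact A1 |].
    eapply load_le_weaken, L.
    unfold Rdiv. rewrite Rmult_assoc. apply Rmult_le_compat_l; [lra|].
    apply Rmult_le_reg_l with K; [lra|].
    rewrite <- Rmult_assoc, Rinv_r, Rmult_1_l by lra.
    apply Rle_trans with (Rpower K s * Rpower (/ beta ^ length G) s).
    - rewrite Rpower_mult_distr by lra. apply Rle_Rpower_l; lra.
    - apply Rmult_le_compat_r; [left; apply Rpower_pos|].
      rewrite <- (Rpower_1 K) at 2 by lra. apply Rle_Rpower; lra. }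
  assert (Cc : 0 <= c <= Rpower (/ beta ^ q) s) by (fold c; lra).
  destruct (HQ (length G)) as [r0 Hr0].
  destruct (pow_exceeds 2 (c / cs)) as [n Hn]; [lra|].
  (* Enough moves both for [Q] and for bringing the relative load below [cs]. *)
  set (r := max r0 n).
  destruct (branching_iterate beta s w h W q H lo hi v U G c r) as
    (G' & O' & LG & P0 & P1 & L' & V); try (assumption || lra).
  assert (P2 : 1 <= 2 ^ r) by (apply pow_R1_Rle; lra).
  assert (Cr : c / 2 ^ r <= cs).
  { assert (2 ^ n <= 2 ^ r) by (apply Rle_pow; [lra | unfold r; lia]).
    apply Rmult_le_reg_r with (2 ^ r); [lra|].
    unfold Rdiv. rewrite Rmult_assoc, Rinv_l, Rmult_1_r by lra.
    apply Rle_trans with (cs * (c / cs)); [right; field; lra|].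
    apply Rmult_le_compat_l; lra. }
  assert (C0 : 0 <= c / 2 ^ r) by (apply Rmult_le_pos; [lra | left; apply Rinv_0_lt_compat; lra]).
  assert (C1 : c / 2 ^ r <= c).
  { apply Rmult_le_reg_r with (2 ^ r); [lra|].
    unfold Rdiv. rewrite Rmult_assoc, Rinv_l, Rmult_1_r by lra.
    rewrite <- (Rmult_1_r c) at 1. apply Rmult_le_compat_l; lra. }
  assert (Cc' : 0 <= c / 2 ^ r <= Rpower (/ beta ^ q) s) by (fold c; lra).
  (* One further move: the closed interval of an inner child lies in the half-open cylinder of [G'],
     so the visit bounds for [G'] hold at its end points too. *)
  destruct (branching_step beta s w h W q H lo hi v U G' (c / 2 ^ r)) as (i & Hi & Li);
    try (assumption || lra).
  destruct B as (_ & BW & _). destruct (BW i Hi) as (Lh & Ih & _).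
  destruct (full_point_le beta (h i) ltac:(lra) (proj1 Ih)) as [F0 F1].
  exists (point beta (G' ++ h i) 0), (point beta (G' ++ h i) 1).
  assert (Eh : point beta (G' ++ h i) 1 - point beta (G' ++ h i) 0 = / beta ^ (length G' + H)).
  { rewrite (point_affine _ _ 1), length_app, Lh. ring. }
  assert (PGh : 0 < / beta ^ (length G' + H)) by (apply Rinv_0_lt_compat, pow_lt; lra).
  split; [|split; [|split]].
  - split; [|lra]. rewrite point_app by lra.
    apply (point_mono beta _ _ G') in F0; lra.
  - rewrite point_app by lra. apply (point_mono beta _ _ G') in F1; lra.
  - rewrite Eh. eapply load_le_weaken, Li.
    apply Rmult_le_compat_r; [left; apply Rpower_pos | lra].
  - intros x Hx.
    destruct (full_of_inner_child beta G' (h i) x) as [X1 X2]; try (assumption || lra).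
    apply (Hr0 r); [unfold r; lia | assumption |].
    specialize (V x X1 X2). rewrite LG in V. exact V.
Qed.

(** Bernoulli's inequality, applied to both factors of b^n * b^n, gives quadratic growth along even
    exponents. *)
Lemma geometric_beats_linear (b C : R) : 1 < b -> exists q, C * (INR q + 1) <= b ^ q.
Proof.
  intros Hb. set (h := b - 1).
  assert (Hh : 0 < h * h) by (unfold h; nra).
  destruct (INR_unbounded (1 + 3 * Rabs C / (h * h))) as [n Hn].
  exists (2 * n)%nat.
  assert (Q : 0 <= Rabs C / (h * h)).
  { apply Rmult_le_pos; [apply Rabs_pos | left; now apply Rinv_0_lt_compat]. }
  assert (Hn1 : 1 <= INR n) by lra.
  assert (HC : 3 * Rabs C <= INR n * (h * h)).
  { apply Rle_trans with (3 * Rabs C / (h * h) * (h * h)); [right; field; nra|].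
    apply Rmult_le_compat_r; lra. }
  assert (P : 1 + INR n * h <= b ^ n).
  { replace b with (1 + h) by (unfold h; ring). apply poly. unfold h. lra. }
  rewrite mult_INR, pow_mult. simpl (INR 2).
  replace ((b ^ 2) ^ n) with (b ^ n * b ^ n) by (rewrite <- pow_mult, <- pow_add; f_equal; lia).
  pose proof (Rle_abs C). pose proof (Rabs_pos C).
  assert (0 <= INR n * h) by (unfold h; nra).
  apply Rle_trans with ((INR n * h) * (INR n * h)); [|nra].
  apply Rle_trans with (Rabs C * (3 * INR n)); nra.
Qed.

Lemma nat_floor (x : R) : 1 <= x -> exists M : nat, INR M <= x < INR M + 1.
Proof.
  intros Hx. destruct (base_Int_part x) as [I1 I2]. exists (Z.to_nat (Int_part x)).
  assert (0 <= Int_part x)%Z by (apply le_IZR; assert (-1 < Int_part x)%Z; [apply lt_IZR; lra|];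
    apply IZR_le; lia).
  rewrite INR_IZR_INZ, Z2Nat.id by assumption. lra.
Qed.

(** The cylinder of [u i] lies within beta^-q of the grid point i / beta^q. On the fibre, [u i]
    accounts for at least N and at most N + |w| visits whatever follows, and [v] adds its own. *)
Lemma branching_fibre beta s w z q M N v lo hi :
  1 < beta < 2 ->
  (forall x q, 0 <= x < 1 -> inner beta (block beta x 0 q ++ repeat 0%nat z)) ->
  INR M <= beta ^ q ->
  opens beta v 1 ->
  (forall y, 0 <= y < 1 -> block beta y 0 (length v) = v ->
     (lo <= visits beta w y (length v) <= hi)%nat) ->
  let u := fun i => block beta (INR i * / beta ^ q) 0 q ++ repeat 0%nat z in
  let W := filter (fun i => Nat.eqb (tau beta w (point beta (u i) 0) (q + z)) N) (seq 0 M) in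
  let H := (q + z + length v)%nat in
  14 * Rpower (beta ^ H) s <= INR (length W) ->
  branching beta s w (fun i => u i ++ v) W q H (N + lo) (N + length w + hi).
Proof.
  intros Hb Hz HM Ov Vv u W H Card.
  assert (Pq : 0 < beta ^ q) by (apply pow_lt; lra).
  assert (Piq : 0 < / beta ^ q) by now apply Rinv_0_lt_compat.
  assert (Eq : beta ^ q * / beta ^ q = 1) by (apply Rinv_r; lra).
  split; [apply NoDup_filter, seq_NoDup|]. split; [|assumption].
  intros i Hi. apply filter_In in Hi. destruct Hi as [Hi EN]. apply Nat.eqb_eq in EN.
  apply in_seq in Hi.
  assert (Hx : 0 <= INR i * / beta ^ q < 1).
  { split; [apply Rmult_le_pos; [apply pos_INR | lra]|].
    rewrite <- Eq. apply Rmult_lt_compat_r; [assumption|].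
    apply Rlt_le_trans with (INR M); [apply lt_INR; lia | assumption]. }
  assert (Lu : length (u i) = (q + z)%nat)
    by (unfold u; now rewrite length_app, block_length, repeat_length).
  pose proof (Hz _ q Hx) as Iu. fold (u i) in Iu.
  split; [rewrite length_app, Lu; reflexivity|].
  split; [apply inner_app; [lra | assumption..]|].
  pose proof (block_point_bounds beta _ q Hb Hx) as Bd.
  rewrite (point_affine _ _ 1), block_length in Bd.
  set (p := point beta (block beta (INR i * / beta ^ q) 0 q)) in *.
  set (zv := repeat 0%nat z ++ v).
  assert (Ozv : opens beta zv 1) by (apply full_app; [lra | apply full_zeros; lra | assumption]).
  destruct (full_point_le beta zv ltac:(lra) Ozv) as [F0 F1].
  assert (Ep : forall y, point beta (u i ++ v) y = p (point beta zv y)).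
  { intros y. unfold u. rewrite <- app_assoc. apply point_app. lra. }
  rewrite !Ep.
  assert (P0 : p 0 <= p (point beta zv 0)) by (apply point_mono; lra).
  assert (P1 : p (point beta zv 1) <= p 0 + 1 * / beta ^ q).
  { apply Rle_trans with (p 1); [apply point_mono; lra|].
    unfold p. rewrite point_affine, block_length. lra. }
  split; [|split].
  - apply Rle_trans with (beta ^ q * (INR i * / beta ^ q - 1 * / beta ^ q)).
    + right. field. lra.
    + apply Rmult_le_compat_l; lra.
  - apply Rle_trans with (beta ^ q * (INR i * / beta ^ q + 1 * / beta ^ q)).
    + apply Rmult_le_compat_l; lra.
    + right. field. lra.
  - intros y Hy E. unfold H in E. rewrite <- Lu in E. apply block_app_inv in E.
    destruct E as [E1 E2]. unfold H. rewrite <- Lu, visits_add.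
    specialize (Vv _ (iter_fbeta_bounds beta y (length (u i)) Hy) E2).
    assert (T : tau beta w y (length (u i)) = N).
    { rewrite <- EN, <- Lu. apply tau_prefix_eq. rewrite E1.
      destruct Iu as [Ou _]. symmetry. apply (Ou 0). lra. }
    pose proof (visits_tau beta w y (length (u i))). lia.
Qed.

(** Both families use the same fibre [W], so the unknown [N] cancels: the straddling error |w| of
    the first stays below the gap between [v1] and [v2], and their visit ranges are disjoint. *)
Lemma branching_pair beta s w :
  1 < beta < 2 -> expansion_of_one_terminates beta -> 0 < s < 1 ->
  (1 <= length w)%nat -> admissible_word beta w ->
  exists h1 h2 W q H A lo hi, (1 <= H)%nat /\
    branching beta s w h1 W q H lo A /\ branching beta s w h2 W q H (A + 1) hi.
Proof.
  intros Hb Ht Hs Lw Aw.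
  destruct (contrasting_words beta w Hb Ht Lw Aw) as (v1 & v2 & B & O1 & O2 & EL & V1 & V2).
  destruct (padding beta Hb Ht) as [z Hz].
  set (C := beta ^ (z + length v1)).
  assert (PC : 1 <= C) by (apply pow_R1_Rle; lra).
  set (b := Rpower beta (1 - s)).
  assert (Pb : 1 < b).
  { apply Rle_lt_trans with (Rpower beta 0); [rewrite Rpower_O; lra | apply Rpower_lt; lra]. }
  (* As beta^q = beta^(q*s) * b^q, the factor b^q has to pay for the 14 in [branching], a 2 for
     rounding beta^q down to [M], the suffix factor [C], and the q + z + 1 possible values of
     [tau]. *)
  destruct (geometric_beats_linear b (28 * C * (INR z + 1)) Pb) as [q Hq].
  assert (Pq : 1 <= beta ^ q) by (apply pow_R1_Rle; lra).
  destruct (nat_floor (beta ^ q) Pq) as [M [HM HM']].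
  set (u := fun i => block beta (INR i * / beta ^ q) 0 q ++ repeat 0%nat z).
  destruct (pigeonhole_fibre (fun i => tau beta w (point beta (u i) 0) (q + z))
              (q + z + 1) (seq 0 M)) as [N HN].
  { intros i _. pose proof (visits_tau beta w (point beta (u i) 0) (q + z)).
    pose proof (visits_le beta w (point beta (u i) 0) (q + z)). lia. }
  set (W := filter (fun i => Nat.eqb (tau beta w (point beta (u i) 0) (q + z)) N) (seq 0 M)) in *.
  assert (Card : 14 * Rpower (beta ^ (q + z + length v1)) s <= INR (length W)).
  { rewrite length_seq in HN. apply le_INR in HN.
    rewrite mult_INR, !plus_INR in HN. simpl (INR 1) in HN.
    assert (M1 : 1 <= INR M).
    { destruct M; [simpl in HM'; lra|]. rewrite S_INR. pose proof (pos_INR M). lra. }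
    rewrite <- Nat.add_assoc, pow_add. fold C.
    rewrite <- Rpower_mult_distr by lra.
    assert (RC : Rpower C s <= C).
    { rewrite <- (Rpower_1 C) at 2 by lra. apply Rle_Rpower; lra. }
    assert (Eq : beta ^ q = Rpower (beta ^ q) s * b ^ q).
    { unfold b. rewrite <- !Rpower_pow by (apply exp_pos || lra).
      rewrite !Rpower_mult, <- Rpower_plus. f_equal. ring. }
    pose proof (Rpower_pos (beta ^ q) s) as Ps.
    set (r := Rpower (beta ^ q) s) in *.
    pose proof (pos_INR q) as Iq. pose proof (pos_INR z) as Iz.
    set (K := INR q + INR z + 1) in *.
    assert (HK : K <= (INR z + 1) * (INR q + 1)) by (unfold K; nra).
    assert (PK : 0 < K) by (unfold K; lra).
    assert (S1 : 28 * C * K <= b ^ q).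
    { eapply Rle_trans; [|exact Hq]. rewrite (Rmult_assoc (28 * C)).
      apply Rmult_le_compat_l; lra. }
    assert (S2 : r * (28 * C * K) <= 2 * (K * INR (length W))).
    { apply Rle_trans with (beta ^ q); [rewrite Eq; apply Rmult_le_compat_l; lra | lra]. }
    assert (S3 : 14 * (r * C) <= INR (length W)).
    { apply Rmult_le_reg_l with K; [assumption | nra]. }
    eapply Rle_trans; [|exact S3].
    apply Rmult_le_compat_l; [lra|]. apply Rmult_le_compat_l; lra. }
  exists (fun i => u i ++ v1), (fun i => u i ++ v2), W, q, (q + z + length v1)%nat,
    (N + length w + B)%nat, (N + 0)%nat, (N + length w + length v2)%nat.
  assert (HL : (1 <= length v2)%nat).
  { destruct (full_point_le beta v2 ltac:(lra) O2) as [F0 F1].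
    destruct (O2 0 ltac:(lra)) as (Y & _ & E). specialize (V2 _ Y E).
    pose proof (visits_le beta w (point beta v2 0) (length v2)). lia. }
  split; [lia|]. split.
  - apply (branching_fibre beta s w z q M N v1 0 B Hb Hz HM O1); [|exact Card].
    intros y Hy E. split; [lia | now apply V1].
  - replace (N + length w + B + 1)%nat with (N + (B + length w + 1))%nat by lia.
    rewrite EL in Card |- *.
    apply (branching_fibre beta s w z q M N v2 (B + length w + 1) (length v2) Hb Hz HM O2);
      [|exact Card].
    intros y Hy E. split; [now apply V2 | apply visits_le].
Qed.

(** * Divergence of frequencies *)

Definition frequency (beta : R) (w : list nat) (x : R) (n : nat) : R :=
  INR (tau beta w x n) / INR (n - length w).

Lemma Rdiv_le_cross (a b c d : R) : 0 < b -> 0 < d -> a * d <= c * b -> a / b <= c / d.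
Proof.
  intros Hb Hd H. apply Rmult_le_reg_r with (b * d); [now apply Rmult_lt_0_compat|].
  replace (a / b * (b * d)) with (a * d) by (field; lra).
  replace (c / d * (b * d)) with (c * b) by (field; lra). assumption.
Qed.

(** The constants 1/3 here and 2/3 in the companion bound separate [A] from [A + 1] visits per
    block. For large [r] one third of a visit per block absorbs the prefix and the |w| missing from
    the denominator. *)
Lemma frequency_le_of_visits beta w x g r H A n :
  (1 <= H)%nat -> (n + 3 * g + 3 * ((A + 1) * length w) + length w + 1 <= r)%nat ->
  (visits beta w x (g + r * H) <= g + r * A)%nat ->
  (n <= g + r * H)%nat /\ frequency beta w x (g + r * H) <= (INR A + 1/3) / INR H.
Proof.
  intros HH Hr V. assert (Lr : (r * 1 <= r * H)%nat) by now apply Nat.mul_le_mono_l.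
  split; [lia|].
  pose proof (visits_tau beta w x (g + r * H)) as [T _].
  assert (T' : INR (tau beta w x (g + r * H)) <= INR g + INR r * INR A).
  { rewrite <- mult_INR, <- plus_INR. apply le_INR. lia. }
  assert (Lw : (length w + 1 <= g + r * H)%nat) by lia.
  apply le_INR in Hr, Lr, Lw. rewrite !plus_INR, !mult_INR, !plus_INR in *. simpl in *.
  assert (HH' : 1 <= INR H) by (change 1 with (INR 1); now apply le_INR).
  unfold frequency. rewrite minus_INR, plus_INR, mult_INR by (apply INR_le; rewrite plus_INR, mult_INR; lra).
  pose proof (pos_INR n). pose proof (pos_INR g). pose proof (pos_INR A).
  pose proof (pos_INR (length w)). pose proof (pos_INR r).
  set (m := INR (length w)) in *. set (t := INR (tau _ _ _ _)) in *.
  set (a := INR A) in *. set (h := INR H) in *. set (k := INR r) in *. set (e := INR g) in *.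
  assert (0 <= a * m) by now apply Rmult_le_pos.
  assert (0 <= a * e) by now apply Rmult_le_pos.
  assert (K : 3 * e + 3 * ((a + 1) * m) <= k) by lra.
  apply (Rmult_le_compat_r h) in K; [|lra].
  assert (K' : (a + 1) * m * 1 <= (a + 1) * m * h) by (apply Rmult_le_compat_l; lra).
  apply (Rmult_le_compat_r h) in T'; [|lra].
  apply Rdiv_le_cross; lra.
Qed.

(** Here the spare third absorbs the |w| occurrences lost from [visits] to [tau] and the prefix
    lengthening the denominator. *)
Lemma frequency_ge_of_visits beta w x g r H A n :
  (1 <= H)%nat -> (n + 3 * length w + 3 * ((A + 1) * g) + length w + 1 <= r)%nat ->
  (r * (A + 1) <= visits beta w x (g + r * H))%nat ->
  (n <= g + r * H)%nat /\ (INR A + 2/3) / INR H <= frequency beta w x (g + r * H).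
Proof.
  intros HH Hr V. assert (Lr : (r * 1 <= r * H)%nat) by now apply Nat.mul_le_mono_l.
  split; [lia|].
  pose proof (visits_tau beta w x (g + r * H)) as [_ T].
  assert (T' : INR r * (INR A + 1) <= INR (tau beta w x (g + r * H)) + INR (length w)).
  { change 1 with (INR 1). rewrite <- !plus_INR, <- mult_INR. apply le_INR. lia. }
  assert (Lw : (length w + 1 <= g + r * H)%nat) by lia.
  apply le_INR in Hr, Lr, Lw. rewrite !plus_INR, !mult_INR, !plus_INR in *. simpl in *.
  assert (HH' : 1 <= INR H) by (change 1 with (INR 1); now apply le_INR).
  unfold frequency. rewrite minus_INR, plus_INR, mult_INR by (apply INR_le; rewrite plus_INR, mult_INR; lra).
  pose proof (pos_INR n). pose proof (pos_INR g). pose proof (pos_INR A).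
  pose proof (pos_INR (length w)). pose proof (pos_INR r).
  set (m := INR (length w)) in *. set (t := INR (tau _ _ _ _)) in *.
  set (a := INR A) in *. set (h := INR H) in *. set (k := INR r) in *. set (e := INR g) in *.
  assert (0 <= a * m) by now apply Rmult_le_pos.
  assert (0 <= a * e) by now apply Rmult_le_pos.
  assert (K : 3 * m + 3 * ((a + 1) * e) <= k) by lra.
  apply (Rmult_le_compat_r h) in K; [|lra].
  assert (K' : (a + 1) * e * 1 <= (a + 1) * e * h) by (apply Rmult_le_compat_l; lra).
  apply (Rmult_le_compat_r h) in T'; [|lra].
  apply Rdiv_le_cross; lra.
Qed.

Lemma oscillation_not_cv (f : nat -> R) (c1 c2 : R) :
  c1 < c2 ->
  (forall n, (exists k, (n <= k)%nat /\ f k <= c1) /\ (exists k, (n <= k)%nat /\ c2 <= f k)) ->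
  ~ exists l, Un_cv f l.
Proof.
  intros Hc H [l L]. destruct (L ((c2 - c1) / 2)) as [N HN]; [lra|].
  destruct (H N) as [(k & K1 & K2) (k' & K1' & K2')].
  pose proof (HN k K1) as D. pose proof (HN k' K1') as D'.
  unfold Rdist in *. apply Rabs_def2 in D, D'. lra.
Qed.

(** Requirement [n] asks for a low and for a high frequency, each at some time after [n]; all of
    them together force oscillation between [c1] and [c2]. *)
Lemma divergence_playable beta s w :
  1 < beta < 2 -> expansion_of_one_terminates beta -> 0 < s < 1 ->
  (1 <= length w)%nat -> admissible_word beta w ->
  exists Q : nat -> R -> Prop, (forall n, playable s (Q n)) /\
    forall x, (forall n, Q n x) -> 0 <= x < 1 /\ ~ exists l, Un_cv (frequency beta w x) l.
Proof.
  intros Hb Ht Hs Lw Aw.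
  destruct (branching_pair beta s w Hb Ht Hs Lw Aw)
    as (h1 & h2 & W & q & H & A & lo & hi & HH & B1 & B2).
  set (c1 := (INR A + 1/3) / INR H). set (c2 := (INR A + 2/3) / INR H).
  exists (fun n x =>
    (0 <= x < 1 /\ exists k, (n <= k)%nat /\ frequency beta w x k <= c1) /\
    (0 <= x < 1 /\ exists k, (n <= k)%nat /\ c2 <= frequency beta w x k)).
  split.
  - intros n. apply playable_and.
    + eapply playable_branching; [exact Hb | exact Ht | exact Hs | exact B1 |].
      (* The number of moves is left open and read off from the size condition of the frequency
         bound. *)
      intros g. eexists. intros r Hr x Hx V. split; [assumption|].
      exists (g + r * H)%nat. apply frequency_le_of_visits; [assumption | exact Hr | apply V].
    + eapply playable_branching; [exact Hb | exact Ht | exact Hs | exact B2 |].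
      intros g. eexists. intros r Hr x Hx V. split; [assumption|].
      exists (g + r * H)%nat. apply frequency_ge_of_visits; [assumption | exact Hr | apply V].
  - intros x Hx. split; [apply (Hx 0%nat)|].
    apply oscillation_not_cv with c1 c2.
    + apply Rmult_lt_compat_r; [apply Rinv_0_lt_compat, lt_0_INR; lia | lra].
    + intros n. destruct (Hx n) as [[_ X1] [_ X2]]. auto.
Qed.

(** * Enumerating all bases, words and times *)

Lemma admissible_digit0 beta : admissible_word beta [0%nat].
Proof.
  exists 0. split; [lra|]. exists 0%nat. cbn. f_equal.
  apply (digit_zero beta 0 0 0 eq_refl). lra.
Qed.

(** Binary digits of [c], least significant first: words are coded by pairs of naturals, so that all
    requirements form one sequence. *)
Fixpoint bits (m c : nat) : list nat :=
  match m with
  | O => []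
  | S m' => (c mod 2)%nat :: bits m' (c / 2)
  end.

Lemma bits_surjective w : binary_word w -> exists c, bits (length w) c = w.
Proof.
  induction 1 as [|d w Hd _ [c IH]]; [now exists 0%nat|].
  exists (d + c * 2)%nat. change ((d + c * 2) mod 2 :: bits (length w) ((d + c * 2) / 2) = d :: w)%nat.
  rewrite Nat.Div0.mod_add, Nat.div_add, Nat.mod_small, (Nat.div_small d) by lia.
  simpl. now rewrite IH.
Qed.

(** Words are taken nonempty and admissible because the frequency of the empty word is eventually 1,
    and that of a word occurring in no expansion is constantly 0. *)
Theorem mainTheorem4 (beta : nat -> R)
  (Hbeta : forall i, 1 < beta i < 2)
  (Hterm : forall i, expansion_of_one_terminates (beta i)) :
  hausdorff_dim_eq
    (fun x : R => 0 <= x < 1 /\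
       forall (i m : nat) (w : list nat),
         (1 <= m)%nat -> length w = m -> binary_word w ->
         admissible_word (beta i) w ->
         ~ (exists l : R,
              Un_cv (fun n : nat => INR (tau (beta i) w x n) / INR (n - m)) l))
    1.
Proof.
  split.
  - intros s [Hs Null]. destruct (Rle_lt_dec 1 s) as [|Hs1]; [assumption|]. exfalso.
    assert (Fam : forall p : nat * (nat * nat), exists Q : nat -> R -> Prop,
      (forall n, playable s (Q n)) /\ forall x, (forall n, Q n x) -> 0 <= x < 1 /\
        let w := bits (fst (snd p)) (snd (snd p)) in
        ((1 <= length w)%nat -> admissible_word (beta (fst p)) w ->
         ~ exists l, Un_cv (frequency (beta (fst p)) w x) l)).
    { intros [i [m c]]. simpl. set (w := bits m c).
      destruct (classic ((1 <= length w)%nat /\ admissible_word (beta i) w)) as [[C1 C2]|C].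
      - destruct (divergence_playable (beta i) s w) as (Q & Q1 & Q2); auto.
        exists Q. split; [assumption|]. intros x Hx. destruct (Q2 x Hx). auto.
      (* Codes of empty or inadmissible words get the requirements of the word 0, which is always
         admissible, as a default. *)
      - destruct (divergence_playable (beta i) s [0%nat]) as (Q & Q1 & Q2);
          auto using admissible_digit0.
        exists Q. split; [assumption|]. intros x Hx. destruct (Q2 x Hx).
        split; [assumption|]. tauto. }
    apply choice_fun in Fam. destruct Fam as [Q HQ].
    set (P := fun j x => let (p, n) := of_nat j in
                let (i, mc) := of_nat p in Q (i, of_nat mc) n x).
    apply (playable_not_null s P Hs).
    { intros j. unfold P. destruct (of_nat j) as [p n]. destruct (of_nat p) as [i mc]. apply HQ. }
    (* The points meeting all requirements form a subset of the given set, so they inherit its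
       covers. *)
    intros delta eps Hd He. destruct (Null delta eps Hd He) as (U & d & N1 & N2 & N3).
    exists U, d. split; [assumption|]. split; [|assumption].
    intros x Px. apply N2.
    assert (Px' : forall i m c n, Q (i, (m, c)) n x).
    { intros i m c n. specialize (Px (to_nat (to_nat (i, to_nat (m, c)), n))).
      unfold P in Px. now rewrite !cancel_of_to in Px. }
    split.
    + apply (proj2 (HQ (0, (0, 0))%nat)). apply Px'.
    + intros i m w Hm Lw Bw Aw. destruct (bits_surjective w Bw) as [c Ec].
      destruct (proj2 (HQ (i, (length w, c))) x (Px' _ _ _)) as [_ D].
      simpl in D. rewrite Ec in D. subst m. now apply D.
  - intros b Hb. destruct (Rle_lt_dec b 1) as [|L]; [assumption|]. exfalso.
    (* A lower bound b > 1 is refuted by the exponent halfway between 1 and b. *)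
    assert (b <= (1 + b) / 2); [|lra]. apply Hb. split; [lra|].
    apply hausdorff_null_unit_interval; [lra | now intros x []].
Qed.
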